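(* Let $\mu,\nu\in P_2(\mathbb{R}^d)$. (i) For $k=1,2$: $$\mathcal{T}_2(\mu,\mathrm{P}^{cx}_{1,\le\nu})=\mathcal{T}_2(\mu,\mathrm{P}^{cx}_{2,\le\nu})=\sup_{\varphi\in\mathcal{A}_{cx}\cap C_{b,k}}\Big\{\int Q_2(\varphi)\,d\mu-\int\varphi\,d\nu\Big\}=\sup_{\varphi\in\mathcal{A}_{cx}\cap L^1(d\nu)}\Big\{\int Q_2(\varphi)\,d\mu-\int\varphi\,d\nu\Big\}.$$ (ii) For $k=1,2$: $$\mathcal{T}_2(\mathrm{P}^{cx}_{1,\mu\le},\nu)=\mathcal{T}_2(\mathrm{P}^{cx}_{2,\mu\le},\nu)=\sup_{\varphi\in\mathcal{A}_{cx}\cap C_{b,k}}\Big\{\int \varphi\,d\mu-\int Q_{\bar 2}(\varphi)\,d\nu\Big\}.$$ In (i) and (ii), $\varphi\in\mathcal{A}_{cx}\cap C_{b,k}$ may be replaced by $\varphi\in\mathcal{A}_{cx}\cap\mathrm{S}_{b,k}$ without changing the value.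
   Context: For $\mu,\nu\in P_1(\mathbb{R}^d)$, $\mu\le_{cx}\nu$ means $\int\varphi\,d\mu\le\int\varphi\,d\nu$ for every real-valued convex $\varphi$ for which both integrals exist in the extended sense. $\mathcal{A}_{cx}$ is the set of proper lower semicontinuous convex functions $\mathbb{R}^d\to\mathbb{R}\cup\{+\infty\}$. $P_k(\mathbb{R}^d)$: Borel probabilities with finite $k$-th moment. $\mathrm{P}^{cx}_{k,\le\nu}=\{\eta\in P_k(\mathbb{R}^d):\eta\le_{cx}\nu\}$, $\mathrm{P}^{cx}_{k,\mu\le}=\{\xi\in P_k(\mathbb{R}^d):\mu\le_{cx}\xi\}$. $\mathcal{T}_2(\mu,\eta)=\inf_{\pi\in\Pi(\mu,\eta)}\int|x-y|^2d\pi$, and $\mathcal{T}_2$ between a measure and a cone is the infimum over the cone. $C_{b,k}$ (resp. $\mathrm{S}_{b,k}$): continuous (resp. measurable) $u$ with $\sup_x|u(x)|/(1+|x|^k)<\infty$. $Q_2(\varphi)(x)=\inf_{y\in\mathbb{R}^d}\{\varphi(y)+|x-y|^2\}$, $Q_{\bar2}(\varphi)(y)=\sup_{x\in\mathbb{R}^d}\{\varphi(x)-|x-y|^2\}$. *)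

(* Defs.v *)
From HB Require Import structures.
From mathcomp Require Import all_boot all_order all_algebra.
From mathcomp Require Import all_classical all_reals all_analysis.
Set Implicit Arguments. Unset Strict Implicit. Unset Printing Implicit Defensive.
Import Order.TTheory GRing.Theory Num.Theory.
Import numFieldNormedType.Exports.
Local Open Scope classical_set_scope.
Local Open Scope ring_scope.

Definition Rd (R : realType) (d : nat) : Type :=
  g_sigma_algebraType (@open 'rV[R]_d).
HB.instance Definition _ (R : realType) (d : nat) :=
  Measurable.on (Rd R d).

Definition enorm (R : realType) (d : nat) (x : 'rV[R]_d) : R :=
  Num.sqrt (\sum_(i < d) (x ord0 i) ^+ 2).
Definition sqdist (R : realType) (d : nat) (x y : 'rV[R]_d) : R :=
  \sum_(i < d) (x ord0 i - y ord0 i) ^+ 2.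

Local Open Scope ereal_scope.

Definition finite_moment (R : realType) (d : nat) (k : nat)
    (mu : probability (Rd R d) R) : Prop :=
  \int[mu]_x ((enorm x) ^+ k)%:E < +oo.

Definition convex_real (R : realType) (d : nat) (phi : 'rV[R]_d -> R) : Prop :=
  forall (x y : 'rV[R]_d) (t : R), (0 <= t <= 1)%R ->
    (phi (t *: x + (1 - t) *: y) <= t * phi x + (1 - t) * phi y)%R.

Definition integral_exists (R : realType) (d : nat)
    (mu : probability (Rd R d) R) (phi : 'rV[R]_d -> R) : Prop :=
  (\int[mu]_x (Num.max (phi x) 0)%:E < +oo) \/
  (\int[mu]_x (Num.max (- phi x) 0)%:E < +oo).

Definition cx_le (R : realType) (d : nat) (mu nu : probability (Rd R d) R) : Prop :=
  forall phi : 'rV[R]_d -> R, convex_real phi ->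
    integral_exists mu phi -> integral_exists nu phi ->
    \int[mu]_x (phi x)%:E <= \int[nu]_x (phi x)%:E.

Definition coupling (R : realType) (d : nat) (mu eta : probability (Rd R d) R)
    (pi : probability (Rd R d * Rd R d)%type R) : Prop :=
  (forall A : set (Rd R d), measurable A -> pi (A `*` setT) = mu A) /\
  (forall A : set (Rd R d), measurable A -> pi (setT `*` A) = eta A).

Definition T2 (R : realType) (d : nat) (mu eta : probability (Rd R d) R) : \bar R :=
  ereal_inf [set \int[pi]_z (sqdist z.1 z.2)%:E
            | pi in [set pi | coupling mu eta pi]].

Definition Pcx_le (R : realType) (d : nat) (k : nat) (nu : probability (Rd R d) R) :
    set (probability (Rd R d) R) :=
  [set eta | finite_moment k eta /\ cx_le eta nu].
Definition Pcx_ge (R : realType) (d : nat) (k : nat) (mu : probability (Rd R d) R) :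
    set (probability (Rd R d) R) :=
  [set xi | finite_moment k xi /\ cx_le mu xi].

Definition T2_to_set (R : realType) (d : nat) (mu : probability (Rd R d) R)
    (S : set (probability (Rd R d) R)) : \bar R :=
  ereal_inf [set T2 mu eta | eta in S].
Definition T2_from_set (R : realType) (d : nat) (S : set (probability (Rd R d) R))
    (nu : probability (Rd R d) R) : \bar R :=
  ereal_inf [set T2 xi nu | xi in S].

Definition A_cx (R : realType) (d : nat) (phi : 'rV[R]_d -> \bar R) : Prop :=
  [/\ (forall x, phi x != -oo),
      (exists x, phi x \is a fin_num),
      lower_semicontinuous phi &
      forall (x y : 'rV[R]_d) (t : R), (0 <= t <= 1)%R ->
        phi (t *: x + (1 - t) *: y)%R <= t%:E * phi x + (1 - t)%:E * phi y].

Definition growth_bound (R : realType) (d : nat) (k : nat) (u : 'rV[R]_d -> R) : Prop :=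
  exists C : R, forall x, (`|u x| <= C * (1 + (enorm x) ^+ k))%R.

Definition C_bk (R : realType) (d : nat) (k : nat) (phi : 'rV[R]_d -> \bar R) : Prop :=
  [/\ (forall x, phi x \is a fin_num),
      continuous (fun x => fine (phi x)) &
      growth_bound k (fun x => fine (phi x))].

Definition S_bk (R : realType) (d : nat) (k : nat) (phi : 'rV[R]_d -> \bar R) : Prop :=
  [/\ (forall x, phi x \is a fin_num),
      measurable_fun [set: Rd R d] (fun x : Rd R d => fine (phi x)) &
      growth_bound k (fun x => fine (phi x))].

Definition Q2 (R : realType) (d : nat) (phi : 'rV[R]_d -> \bar R) (x : 'rV[R]_d) : \bar R :=
  ereal_inf [set phi y + (sqdist x y)%:E | y in [set: 'rV[R]_d]].
Definition Q2bar (R : realType) (d : nat) (phi : 'rV[R]_d -> \bar R) (y : 'rV[R]_d) : \bar R :=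
  ereal_sup [set phi x - (sqdist x y)%:E | x in [set: 'rV[R]_d]].

Definition dual_i (R : realType) (d : nat) (mu nu : probability (Rd R d) R)
    (C : set ('rV[R]_d -> \bar R)) : \bar R :=
  ereal_sup [set \int[mu]_x Q2 phi x - \int[nu]_x phi x | phi in C].
Definition dual_ii (R : realType) (d : nat) (mu nu : probability (Rd R d) R)
    (C : set ('rV[R]_d -> \bar R)) : \bar R :=
  ereal_sup [set \int[mu]_x phi x - \int[nu]_x Q2bar phi x | phi in C].

(* Main.v *)
Require Import Defs.
From HB Require Import structures.
From mathcomp Require Import all_boot all_order all_algebra.
From mathcomp Require Import all_classical all_reals all_analysis.
From mathcomp Require Import measurable_realfun ring lra.
Set Implicit Arguments. Unset Strict Implicit. Unset Printing Implicit Defensive.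
Import Order.TTheory GRing.Theory Num.Theory.
Import numFieldNormedType.Exports.
Local Open Scope classical_set_scope.
Local Open Scope ring_scope.

(** The common value of all the quantities is that of the functional
      J(p, a) = int max_i (p_i.x - a_i - |p_i|^2/4) dmu - int max_i (p_i.y - a_i) dnu
    over finite families of affine functions.  For the dual problems, J is a
    lower bound: phi = max_i (p_i.y - a_i) in (i) and
    phi = max_i (p_i.x - a_i - |p_i|^2/4) in (ii) are convex and Lipschitz.

    For the primal problems, mu is quantized into finitely many cells with
    barycentres x_i and masses m_i > 0, and nu is split by a measurable
    partition of unity (h_i) with int h_i dnu = m_i and barycentres z_i.  Moving
    the cell i to z_i gives a measure dominated by nu; gluing X in cell i with
    Y of law h_i nu / m_i independently and taking the law of X + Y - z_i gives
    a measure dominating mu, at the same distance from nu.  Both cost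
    int |x - z_i|^2 dmu, that is sum_i m_i |x_i - z_i|^2 up to the quantization
    error.

    A partition of unity with p_i = 2 (x_i - z_i) nearly optimal for J is found
    without compactness or linear programming duality: the constraints
    int h_i dnu = m_i are penalized quadratically, the slopes of the penalty
    are the multipliers a_i, near-minimality is tested against the selection of
    the largest p_i.y - a_i, and the constraints are finally restored by mixing
    with a constant partition. *)

(** * Expectations, image measures and densities *)
Section RealExpectation.
Context (R : realType) (dT : measure_display) (T : measurableType dT).
Implicit Types (P : probability T R) (f g : T -> R).

Definition L1 P f : Prop := P.-integrable setT (EFin \o f).
(** Real-valued, so that ordinary arithmetic applies to it. An infinite integral would be read as 0,
    whence the [L1] hypotheses of the linearity lemmas. *)
Definition E P f : R := Rintegral P setT f.

Lemma L1_meas P f : L1 P f -> measurable_fun setT f.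
Proof. by move=> /measurable_int/measurable_EFinP. Qed.

Lemma L1_cst P (c : R) : L1 P (fun=> c).
Proof. exact: finite_measure_integrable_cst. Qed.

Lemma L1D P f g : L1 P f -> L1 P g -> L1 P (fun x => f x + g x).
Proof. by move=> hf hg; exact: (integrableD measurableT hf hg). Qed.

Lemma L1B P f g : L1 P f -> L1 P g -> L1 P (fun x => f x - g x).
Proof. by move=> hf hg; exact: (integrableB measurableT hf hg). Qed.

Lemma L1Z P c f : L1 P f -> L1 P (fun x => c * f x).
Proof. by move=> hf; exact: (integrableZl measurableT c hf). Qed.

Lemma L1_sum P (I : Type) (s : seq I) (Q : pred I) (F : I -> T -> R) :
  (forall i, L1 P (F i)) -> L1 P (fun x => \sum_(i <- s | Q i) F i x).
Proof.
move=> h; elim: s => [|i s ih].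
  by under eq_fun do rewrite big_nil; exact: L1_cst.
under eq_fun do rewrite big_cons.
by case: (Q i) => //; exact: L1D.
Qed.

Lemma L1_le P f g : measurable_fun setT f -> (forall x, `|f x| <= g x) ->
  L1 P g -> L1 P f.
Proof.
move=> mf fg; apply: le_integrable => //; first exact/measurable_EFinP.
by move=> x _ /=; rewrite lee_fin (le_trans (fg x))// ler_norm.
Qed.

Lemma L1_norm P f : L1 P f -> L1 P (fun x => `|f x|).
Proof. exact: integrable_norm. Qed.

Lemma L1_ge0 P f : measurable_fun setT f -> (forall x, 0 <= f x) ->
  (\int[P]_x (f x)%:E < +oo)%E -> L1 P f.
Proof.
move=> mf f0 h; apply/integrableP; split; first exact/measurable_EFinP.
apply: le_lt_trans h; rewrite le_eqVlt; apply/orP; left; apply/eqP.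
by apply: eq_integral => x _ /=; rewrite ger0_norm.
Qed.

Lemma integral_E P f : L1 P f -> (\int[P]_x (f x)%:E = (E P f)%:E)%E.
Proof. by move=> hf; rewrite /E/Rintegral fineK//; exact: integrable_fin_num. Qed.

Lemma eq_E P f g : f =1 g -> E P f = E P g.
Proof. by move=> /funext ->. Qed.

Lemma E_cst P c : E P (fun=> c) = c.
Proof. by rewrite /E Rintegral_cst//; rewrite [X in fine X](@probability_setT _ _ _ P) mulr1. Qed.

Lemma E_D P f g : L1 P f -> L1 P g -> E P (fun x => f x + g x) = E P f + E P g.
Proof. exact: RintegralD. Qed.

Lemma E_B P f g : L1 P f -> L1 P g -> E P (fun x => f x - g x) = E P f - E P g.
Proof. exact: RintegralB. Qed.

Lemma E_Z P c f : L1 P f -> E P (fun x => c * f x) = c * E P f.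
Proof. exact: RintegralZl. Qed.

Lemma E_sum P (I : Type) (s : seq I) (Q : pred I) (F : I -> T -> R) :
  (forall i, L1 P (F i)) ->
  E P (fun x => \sum_(i <- s | Q i) F i x) = \sum_(i <- s | Q i) E P (F i).
Proof.
move=> h; elim: s => [|i s ih].
  by under eq_E do rewrite big_nil; rewrite E_cst big_nil.
under eq_E do rewrite big_cons.
rewrite big_cons; case: (Q i) => //; rewrite E_D ?ih//; exact: L1_sum.
Qed.

Lemma E_le P f g : L1 P f -> L1 P g -> (forall x, f x <= g x) -> E P f <= E P g.
Proof. by move=> hf hg fg; exact: le_Rintegral. Qed.

Lemma E_ge0 P f : (forall x, 0 <= f x) -> 0 <= E P f.
Proof. by move=> h; exact: Rintegral_ge0. Qed.

(* Monotonicity needs no integrability: the convention oo - oo = -oo makes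
   the difference of the positive and negative parts monotone. *)
Lemma integral_mono P (f g : T -> \bar R) :
  measurable_fun setT f -> measurable_fun setT g -> (forall x, f x <= g x)%E ->
  (\int[P]_x f x <= \int[P]_x g x)%E.
Proof.
move=> mf mg fg; rewrite integralE [leRHS]integralE leeB//.
- apply: ge0_le_integral => //; [exact: measurable_funepos..|].
  by move=> x _; apply: (@funepos_le _ _ setT) => [y _|]; [exact: fg|rewrite inE].
- apply: ge0_le_integral => //; [exact: measurable_funeneg..|].
  by move=> x _; apply: (@funeneg_le _ _ setT) => [y _|]; [exact: fg|rewrite inE].
Qed.

End RealExpectation.

Section Pushforward.
Context (R : realType) (d1 d2 : measure_display).
Context (T1 : measurableType d1) (T2 : measurableType d2).

Definition push (P : probability T1 R) (f : T1 -> T2)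
    (mf : measurable_fun setT f) : probability T2 R :=
  distribution P (HB.pack f (isMeasurableFun.Build _ _ _ _ _ mf)).

Lemma pushE (P : probability T1 R) f (mf : measurable_fun setT f) A :
  push P mf A = P (f @^-1` A).
Proof. by []. Qed.

Lemma ge0_integral_push (P : probability T1 R) f (mf : measurable_fun setT f)
    (g : T2 -> \bar R) :
  measurable_fun setT g -> (forall y, 0 <= g y)%E ->
  (\int[push P mf]_y g y = \int[P]_x g (f x))%E.
Proof. by move=> mg g0; apply: ge0_integral_pushforward. Qed.

Lemma integral_push (P : probability T1 R) f (mf : measurable_fun setT f)
    (g : T2 -> \bar R) :
  measurable_fun setT g ->
  (\int[push P mf]_y g y = \int[P]_x g (f x))%E.
Proof.
move=> mg.
have mp : measurable_fun setT g^\+%E by exact: measurable_funepos.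
have mn : measurable_fun setT g^\-%E by exact: measurable_funeneg.
by rewrite integralE [RHS]integralE; congr (_ - _)%E; rewrite ge0_integral_push//;
  by apply: eq_integral => x _; rewrite ?funeposE ?funenegE.
Qed.

Lemma eq_prob_integral (P Q : probability T1 R) (g : T1 -> \bar R) :
  (forall A, measurable A -> P A = Q A) ->
  (\int[P]_y g y = \int[Q]_x g x)%E.
Proof. by move=> h; apply: eq_measure_integral => A mA _; exact: h. Qed.

End Pushforward.

Section Density.
Context (R : realType) (dT : measure_display) (T : measurableType dT).
Variables (P : {measure set T -> \bar R}) (f : T -> R).
Hypotheses (mf : measurable_fun setT f) (f0 : forall x, 0 <= f x).
Local Open Scope ereal_scope.

(** The proofs of measurability and nonnegativity are arguments so that the measure structure built
    from them can be attached to this name. *)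
Definition dens (_ : measurable_fun setT f) (_ : forall x, (0 <= f x)%R)
  (A : set T) : \bar R := \int[P]_(x in A) (f x)%:E.

Let nu := dens mf f0.
Let dens0 : nu set0 = 0. Proof. exact: integral_set0. Qed.
Let dens_ge0 A : 0 <= nu A.
Proof. by apply: integral_ge0 => x _; rewrite lee_fin. Qed.
Let dens_sigma : semi_sigma_additive nu.
Proof.
move=> F mF tF mU; rewrite /nu/dens ge0_integral_bigcup//=.
- apply: is_cvg_ereal_nneg_natsum_cond => n _ _; exact: dens_ge0.
- by apply/measurable_EFinP; exact: measurable_funTS.
- by move=> x _; rewrite lee_fin.
Qed.
HB.instance Definition _ :=
  isMeasure.Build _ _ _ nu dens0 dens_ge0 dens_sigma.

Hypothesis f1 : \int[P]_x (f x)%:E = 1.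
Let dens1 : nu setT = 1. Proof. exact: f1. Qed.
HB.instance Definition _ := Measure_isProbability.Build _ _ _ nu dens1.
Definition dens_prob : probability T R := nu.

Import HBNNSimple.

(** Both sides are monotone limits along simple functions approximating [g]. For a simple function
    they agree level set by level set, where the identity is the definition of [dens]. *)
Lemma dens_integral (g : T -> \bar R) : measurable_fun setT g ->
  (forall x, 0 <= g x) ->
  \int[dens_prob]_x g x = \int[P]_x (g x * (f x)%:E).
Proof.
move=> mg g0.
pose g_ := nnsfun_approx measurableT mg.
transitivity (limn (fun n => \int[dens_prob]_x (g_ n x)%:E)).
  rewrite -monotone_convergence//.
  - apply: eq_integral => y _; apply/esym/cvg_lim => //.
    by apply: cvg_nnsfun_approx.
  - by move=> n; exact/measurable_EFinP.
  - by move=> n y _; rewrite lee_fin.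
  - by move=> y _ m n mn; rewrite lee_fin; exact/lefP/nd_nnsfun_approx.
transitivity (limn (fun n => \int[P]_x ((g_ n x)%:E * (f x)%:E))); last first.
  rewrite -monotone_convergence//.
  - apply: eq_integral => y _; apply/cvg_lim => //.
    apply: cvgeZr => //; by apply: cvg_nnsfun_approx.
  - by move=> n; apply: emeasurable_funM; exact/measurable_EFinP.
  - by move=> n y _; rewrite -EFinM lee_fin mulr_ge0.
  - move=> y _ m n mn; rewrite -!EFinM lee_fin ler_wpM2r//.
    exact/lefP/nd_nnsfun_approx.
congr (limn _); apply/funext => n.
rewrite integralT_nnsfun sintegralE.
transitivity (\sum_(r \in range (g_ n)) \int[P]_x (r * (\1_(g_ n @^-1` [set r]) x * f x))%:E).
  apply: eq_fsbigr => r /set_mem [x _ rE].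
  have r0 : (0 <= r)%R by rewrite -rE.
  under eq_integral do rewrite EFinM.
  rewrite ge0_integralZl_EFin//; last 2 first.
  - by move=> y _; rewrite lee_fin mulr_ge0.
  - apply/measurable_EFinP/measurable_funM => //; exact: measurable_indic.
  congr (_ * _); rewrite /= /dens. rewrite [LHS]integral_mkcond; apply: eq_integral => y _.
  rewrite patchE indicE; case: (y \in _); first by rewrite mul1r.
  by rewrite mul0r.
rewrite -ge0_integral_fsum//; last 2 first.
- move=> r; apply/measurable_EFinP; apply: measurable_funM => //.
  by apply: measurable_funM => //; exact: measurable_indic.
- move=> r y _; rewrite lee_fin indicE; case: (boolP (_ \in _)) => [|_].
    by rewrite inE => /= <-; rewrite mul1r mulr_ge0.
  by rewrite mul0r mulr0.
apply: eq_integral => y _; rewrite fsumEFin// -EFinM; congr (_%:E).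
under eq_fsbigr do rewrite mulrA.
rewrite -mulr_fsuml; congr (_ * _)%R.
by rewrite [RHS](fimfunE (g_ n) y).
Qed.

End Density.

(** * Euclidean structure and subgradients *)
Section Dot.
Context (R : realType) (d : nat).
Implicit Types (x y z p : 'rV[R]_d).

Definition dot x y : R := \sum_(k < d) x ord0 k * y ord0 k.

Lemma dotC x y : dot x y = dot y x.
Proof. by apply: eq_bigr => k _; rewrite mulrC. Qed.
Lemma dotDr x y z : dot x (y + z) = dot x y + dot x z.
Proof. by rewrite -big_split; apply: eq_bigr => k _; rewrite !mxE mulrDr. Qed.
Lemma dotZr c x y : dot x (c *: y) = c * dot x y.
Proof. by rewrite mulr_sumr; apply: eq_bigr => k _; rewrite !mxE mulrCA. Qed.
Lemma dotNr x y : dot x (- y) = - dot x y.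
Proof. by rewrite -scaleN1r dotZr mulN1r. Qed.
Lemma dotDl x y z : dot (y + z) x = dot y x + dot z x.
Proof. by rewrite !(dotC _ x) dotDr. Qed.
Lemma dotZl c x y : dot (c *: y) x = c * dot y x.
Proof. by rewrite !(dotC _ x) dotZr. Qed.
Lemma dotNl x y : dot (- y) x = - dot y x.
Proof. by rewrite !(dotC _ x) dotNr. Qed.
Lemma dot0r x : dot x 0 = 0.
Proof. by rewrite -(scale0r x) dotZr mul0r. Qed.
Definition dotE := (dotDr, dotDl, dotNr, dotNl, dotZr, dotZl).

Lemma sqdistE x y : sqdist x y = dot x x - 2 * dot x y + dot y y.
Proof.
rewrite /sqdist /dot mulr_sumr -sumrB -big_split /=.
by apply: eq_bigr => k _; ring.
Qed.
Lemma sqdist_dot x y : sqdist x y = dot (x - y) (x - y).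
Proof. by rewrite sqdistE !dotE (dotC y x); ring. Qed.
Lemma dot_ge0 x : 0 <= dot x x.
Proof. by apply: sumr_ge0 => k _; rewrite -expr2 sqr_ge0. Qed.
Lemma sqdist_ge0 x y : 0 <= sqdist x y.
Proof. by rewrite sqdist_dot dot_ge0. Qed.
Lemma enorm2 x : enorm x ^+ 2 = dot x x.
Proof.
rewrite /enorm sqr_sqrtr; last by apply: sumr_ge0 => k _; exact: sqr_ge0.
by apply: eq_bigr => k _; rewrite expr2.
Qed.
Lemma enorm_ge0 x : 0 <= enorm x. Proof. exact: sqrtr_ge0. Qed.
Lemma coord_le_enorm x k : `|x ord0 k| <= enorm x.
Proof.
rewrite -(@ler_pXn2r _ 2%N) ?nnegrE ?enorm_ge0// enorm2 real_normK ?num_real//.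
by rewrite /dot (bigD1 k)//= -expr2 lerDl sumr_ge0// => i _; rewrite -expr2 sqr_ge0.
Qed.
Lemma dot_le_enorm p x : `|dot p x| <= (\sum_k `|p ord0 k|) * enorm x.
Proof.
rewrite /dot (le_trans (ler_norm_sum _ _ _))// mulr_suml ler_sum// => k _.
by rewrite normrM ler_wpM2l// coord_le_enorm.
Qed.
Lemma enorm_le_sum x : enorm x <= \sum_k `|x ord0 k|.
Proof.
rewrite -(@ler_pXn2r _ 2%N) ?nnegrE ?enorm_ge0 ?sumr_ge0// enorm2.
rewrite expr2 mulr_suml ler_sum// => k _.
rewrite (le_trans (ler_norm _))// normrM ler_wpM2l//.
by rewrite (bigD1 k)//= lerDl sumr_ge0.
Qed.

Lemma mxnorm_coord x k : `|x ord0 k| <= `|x|.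
Proof.
rewrite [leRHS]mx_normrE (le_trans _ (le_bigmax _ _ (ord0, k)))//.
Qed.
(** The topology of row vectors comes from the sup norm while moments use [enorm]; this lemma and
    the next compare the two. *)
Lemma mxnorm_le_enorm x : `|x| <= enorm x.
Proof.
rewrite [leLHS]mx_normrE; apply: bigmax_le; first exact: enorm_ge0.
by move=> [i k] _ /=; rewrite (ord1 i) coord_le_enorm.
Qed.
Lemma enorm_le_mxnorm x : enorm x <= d%:R * `|x|.
Proof.
rewrite (le_trans (enorm_le_sum x))//.
rewrite (le_trans (ler_sum _ (fun k _ => mxnorm_coord x k)))//.
by rewrite sumr_const card_ord [leRHS]mulr_natl.
Qed.

Lemma continuous_dot p : continuous (dot p).
Proof.
rewrite /dot; apply: continuous_big => [|k _ x]; first exact: add_continuous.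
apply: (@cvgM _ _ (nbhs x) _ (cst (p ord0 k)) (fun y : 'rV[R]_d => y ord0 k)); first exact: cvg_cst.
exact: coord_continuous.
Qed.

End Dot.

Section Subgradient.
Context (R : realType) (d : nat).
Implicit Types (x y z p w : 'rV[R]_d).
Variable (phi : 'rV[R]_d -> R).
Hypothesis cphi : convex_real phi.

(** The span of the first [k] basis vectors, on which a partial subgradient is tested. *)
Let supp (k : nat) w := forall i : 'I_d, (k <= i)%N -> w ord0 i = 0.

(* One step of the Hahn-Banach extension, along the k-th coordinate. *)
Let extend z (k : 'I_d) p :
  (forall w, supp k w -> phi z + dot p w <= phi (z + w)) ->
  exists p', forall w, supp k.+1 w -> phi z + dot p' w <= phi (z + w).
Proof.
move=> hp; pose e : 'rV[R]_d := delta_mx ord0 k.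
(* The lower bounds that points on the negative side impose on the slope along [e]. By [key] they
   lie below all upper bounds from the positive side, so their supremum is an admissible slope. *)
pose S := [set r : R | exists w s, [/\ supp k w, 0 < s &
  r = (phi z + dot p w - phi (z + w - s *: e)) / s]].
have key w w' s s' : supp k w -> supp k w' -> 0 < s -> 0 < s' ->
  (phi z + dot p w - phi (z + w - s *: e)) / s <=
  (phi (z + w' + s' *: e) - phi z - dot p w') / s'.
  move=> sw sw' s0 s'0.
  have ss : 0 < s + s' by rewrite addr_gt0.
  have t01 : 0 <= s' / (s + s') <= 1.
    by rewrite divr_ge0 ?(ltW s'0) ?(ltW ss)//= ler_pdivrMr// mul1r lerDr ltW.
  (* The weights make the components along [e] cancel, so that the combination falls back on
     [supp k], where [hp] applies. *)
  have := cphi (z + w - s *: e) (z + w' + s' *: e) t01.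
  pose u := (s' / (s + s')) *: w + (1 - s' / (s + s')) *: w'.
  have -> : (s' / (s + s')) *: (z + w - s *: e) +
    (1 - s' / (s + s')) *: (z + w' + s' *: e) = z + u.
    apply/rowP => i; rewrite !mxE; field; lra.
  have su : supp k u.
    by move=> i ki; rewrite !mxE sw// sw'// !mulr0 addr0.
  have := hp u su.
  rewrite /u !dotE => h1 h2.
  have h := le_trans h1 h2; move: h.
  rewrite ler_pdivrMr// -(ler_pM2l ss) => h.
  rewrite mulrAC ler_pdivlMr//.
  have E1 : (s + s') * (phi z + (s' / (s + s') * dot p w + (1 - s' / (s + s')) * dot p w'))
    = (s + s') * phi z + s' * dot p w + s * dot p w' by field; lra.
  have E2 : (s + s') * (s' / (s + s') * phi (z + w - s *: e) +
     (1 - s' / (s + s')) * phi (z + w' + s' *: e)) =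
    s' * phi (z + w - s *: e) + s * phi (z + w' + s' *: e) by field; lra.
  rewrite E1 E2 in h; nra.
have s0w : supp k 0 by move=> i _; rewrite mxE.
have S0 : S !=set0.
  by exists ((phi z + dot p 0 - phi (z + 0 - 1 *: e)) / 1); exists 0, 1; split.
have Sub : has_ubound S.
  exists ((phi (z + 0 + 1 *: e) - phi z - dot p 0) / 1) => _ [w [s [sw s0 ->]]].
  exact: key.
pose c := sup S.
have clo w s : supp k w -> 0 < s -> (phi z + dot p w - phi (z + w - s *: e)) / s <= c.
  by move=> sw s0; apply: ub_le_sup => //; exists w, s.
have chi w s : supp k w -> 0 < s -> c <= (phi (z + w + s *: e) - phi z - dot p w) / s.
  move=> sw s0; apply: ge_sup => // _ [w' [s' [sw' s'0 ->]]]; exact: key.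
pose p' : 'rV[R]_d := \row_i if i == k then c else p ord0 i.
exists p' => w sw.
pose t := w ord0 k; pose w0 := w - t *: e.
have sw0 : supp k w0.
  move=> i; rewrite leq_eqVlt => /orP[/eqP ki|ki].
    have -> : i = k by exact/val_inj.
    by rewrite !mxE !eqxx /t mulr1 subrr.
  rewrite !mxE sw//.
  have -> : (i == k) = false by apply/eqP => ik; rewrite ik ltnn in ki.
  by rewrite andbF mulr0 subr0.
have pw : dot p' w = dot p w0 + c * t.
  rewrite /dot (bigD1 k)//= [in RHS](bigD1 k)//= !mxE !eqxx mulr1 /t subrr mulr0.
  rewrite add0r addrC; congr (_ + _); apply: eq_bigr => i ik.
  by rewrite !mxE (negbTE ik) andbF mulr0 subr0.
have wE : w = w0 + t *: e by rewrite /w0 subrK.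
rewrite pw wE (addrA z).
have [t0|t0|t0] := ltrgtP t 0.
- have := clo w0 (- t) sw0; rewrite oppr_gt0 => /(_ t0).
  by rewrite scaleNr opprK ler_pdivrMr ?oppr_gt0//; lra.
- by have := chi w0 t sw0 t0; rewrite ler_pdivlMr//; lra.
- by rewrite t0 scale0r addr0 mulr0 addr0; exact: hp.
Qed.

(** The zero functional works on the zero subspace, and [extend] is applied once for each
    coordinate. *)
Lemma subgradient z : exists p, forall y, phi z + dot p (y - z) <= phi y.
Proof.
have [p hp] : exists p, forall w, supp d w -> phi z + dot p w <= phi (z + w).
  have H k : (k <= d)%N ->
      exists p, forall w, supp k w -> phi z + dot p w <= phi (z + w); last exact: H.
  elim: k => [_|k ih kd].
    exists 0 => w sw; have -> : w = 0 by apply/rowP => i; rewrite sw// mxE.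
    by rewrite dot0r !addr0.
  have [p hp] := ih (ltnW kd).
  exact: (@extend z (Ordinal kd) p hp).
exists p => y; have := hp (y - z); rewrite (addrC z) subrK; apply => i.
by rewrite leqNgt ltn_ord.
Qed.

End Subgradient.

(** * Borel structure of R^d *)
Section BorelRd.
Context (R : realType) (d : nat).
Local Notation V := 'rV[R]_d.

Lemma Rd_open_meas (U : set V) : open U -> measurable (U : set (Rd R d)).
Proof. by move=> oU; apply: sub_sigma_algebra. Qed.

Lemma Rd_lsc_meas (f : V -> \bar R) : (forall a, open [set x | a%:E < f x]%E) ->
  measurable_fun [set: Rd R d] (f : Rd R d -> \bar R).
Proof.
move=> h; apply: (measurability _ (ErealGenOInfty.measurableE R)).
move=> /= _ [_ [a ->]] <-; apply: measurableI => //.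
by rewrite preimage_itvoy; apply: Rd_open_meas; exact: h.
Qed.

Lemma Rd_usc_meas (f : V -> \bar R) : (forall a, open [set x | f x < a%:E]%E) ->
  measurable_fun [set: Rd R d] (f : Rd R d -> \bar R).
Proof.
move=> h.
have m : measurable_fun [set: Rd R d] (fun x : Rd R d => - f x)%E.
  apply: (@Rd_lsc_meas (fun x => - f x)%E) => a.
  rewrite (_ : [set x | _] = [set x | f x < (- a)%:E]%E)//.
  by apply/seteqP; split => x /=; rewrite lteNr EFinN.
rewrite (_ : f = (fun x : Rd R d => - - f x)%E); first exact: measurableT_comp.
by apply/funext => x; rewrite oppeK.
Qed.

Lemma open_gt_continuous (f : V -> R) a : continuous f -> open [set x | a < f x].
Proof.
move=> cf; have := @open_comp _ _ f [set r | a < r].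
by move/(_ (fun x _ => cf x) (@open_gt _ a)).
Qed.

Lemma Rd_cont_meas (f : V -> R) : continuous f ->
  measurable_fun [set: Rd R d] (f : Rd R d -> R).
Proof.
move=> cf; apply/measurable_EFinP; apply: (@Rd_lsc_meas (EFin \o f)) => a.
exact: (@open_gt_continuous f a cf).
Qed.

Lemma Rd_meas_coord (k : 'I_d) :
  measurable_fun [set: Rd R d] (fun x : Rd R d => (x : V) ord0 k).
Proof. by apply: Rd_cont_meas; exact: coord_continuous. Qed.

(* An open set of R^d is a countable union of balls of rational centre and
   radius for the sup norm, and such a ball is a box. *)
Lemma Rd_meas_fun (dT : measure_display) (T : measurableType dT) (f : T -> Rd R d) :
  (forall k, measurable_fun setT (fun t => (f t : V) ord0 k)) ->
  measurable_fun setT f.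
Proof.
move=> hf.
have hG : @measurable _ (Rd R d) = <<s @open V >> by [].
apply: (measurability _ hG).
move=> _ [U oU <-]; rewrite setTI.
pose qb (q : 'rV[rat]_d * rat) := [set x : V | forall k,
  (ratr (q.1 ord0 k) - ratr q.2 < x ord0 k < ratr (q.1 ord0 k) + ratr q.2)].
have UE : U = \bigcup_(q in [set q | qb q `<=` U]) qb q.
  apply/seteqP; split=> [x Ux|x [q /= qU qx]]; last exact: qU.
  have /nbhs_ballP[e /= e0 eU] := open_nbhs_nbhs (conj oU Ux).
  have [r /andP[r0 re]] : exists r : rat, 0 < (ratr r : R) < e / 2.
    have [r] := rat_in_itvoo (divr_gt0 e0 (ltr0Sn R 1)).
    by rewrite in_itv/=; exists r.
  have hq k : exists q : rat, x ord0 k - ratr r < (ratr q : R) < x ord0 k.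
    have xr : x ord0 k - ratr r < x ord0 k by rewrite ltrBlDr ltrDl.
    by have [q] := rat_in_itvoo xr; rewrite in_itv/=; exists q.
  have [q hq'] := choice hq.
  exists (\row_k q k, r) => /=; last first.
    by move=> k; rewrite mxE /=; have /andP[] := hq' k; lra.
  move=> y hy; apply: eU.
  split => // i k; rewrite (ord1 i) /ball /=.
  have := hy k; rewrite mxE /= => /andP[h1 h2]; have /andP[h3 h4] := hq' k.
  rewrite ltr_norml; apply/andP; split; lra.
rewrite UE preimage_bigcup.
rewrite bigcup_mkcond; apply: countable_bigcupT_measurable => [|q]; first exact: countableP.
case: ifP => // _.
rewrite (_ : _ @^-1` _ = \bigcap_(k in setT) ((fun t => (f t : V) ord0 k) @^-1`
   `]ratr (q.1 ord0 k) - ratr q.2, ratr (q.1 ord0 k) + ratr q.2[ )); last first.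
  apply/seteqP; split => [t ht k _|t ht k] /=; first by rewrite in_itv /=; exact: ht.
  by have := ht k Logic.I; rewrite /= in_itv.
apply: fin_bigcap_measurable => // k _.
rewrite -[X in measurable X]setTI; exact: hf.
Qed.

End BorelRd.

(** * Measurable selection of a maximal index in a finite family *)

Section Selection.
Context (R : realType) (T : Type).
Variables (I : finType) (i0 : I) (l : I -> T -> R).

(** The choice depends only on the finite table of comparisons, which reduces its measurability to
    that of finitely many tests. The default [i0] is returned only for tables without a maximal
    index, which do not come from real values. *)
Definition best (v : {ffun I * I -> bool}) : I :=
  odflt i0 [pick i | [forall j, v (j, i)]].

Definition sel (y : T) : I := best [ffun k : I * I => l k.1 y <= l k.2 y].

Lemma sel_max j y : l j y <= l (sel y) y.
Proof.
rewrite /sel /best; case: pickP => [i /forallP/(_ j)|]; first by rewrite ffunE.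
case: (@arg_maxP _ _ _ i0 xpredT (l ^~ y) isT) => i _ hi /(_ i)/negP[].
by apply/forallP => k; rewrite ffunE; exact: hi.
Qed.

End Selection.

Section FiniteSelection.
Context (R : realType) (dT : measure_display) (T : measurableType dT).

(** The set is a finite union, over the codes [v] in [G], of the finite intersections on which every
    test takes the value given by [v]. *)
Lemma meas_fin_code (K : finType) (c : K -> T -> bool) (G : set {ffun K -> bool}) :
  (forall k, measurable [set y | c k y]) ->
  measurable [set y | G [ffun k => c k y]].
Proof.
move=> mc.
rewrite (_ : [set y | _] = \bigcup_(v in G) \bigcap_(k in setT) [set y | c k y = v k]).
  apply: fin_bigcup_measurable => [|v _]; first exact: finite_finset.
  apply: fin_bigcap_measurable => // k _.
  case: (v k); first exact: (mc k).
  rewrite (_ : [set y | _] = ~` [set y | c k y]); first exact: measurableC.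
  by apply/seteqP; split => y /=; [move=> ->|move/negP/negbTE].
apply/seteqP; split => [y Gy|y [v Gv vy]] /=.
  by exists [ffun k => c k y] => // k _; rewrite /= ffunE.
by rewrite (_ : [ffun k => c k y] = v)//; apply/ffunP => k; rewrite ffunE vy.
Qed.

Variables (I : finType) (i0 : I) (l : I -> T -> R).
Hypothesis ml : forall i, measurable_fun setT (l i).

Lemma sel_meas i : measurable [set y | sel i0 l y = i].
Proof.
apply: (@meas_fin_code _ (fun k y => l k.1 y <= l k.2 y) [set v | best i0 v = i]) => k.
have := @measurable_fun_ler _ _ _ setT _ _ (ml k.1) (ml k.2).
move=> /(_ measurableT [set true]) /=; rewrite setTI; apply.
by [].
Qed.

End FiniteSelection.

(** Turns a value at a selected index into a finite sum weighted by indicators, to which linearity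
    of the integral applies. *)
Lemma sum_pick (R : realType) (T : Type) (I : finType) (s : T -> I) (f : I -> R) y : f (s y) = \sum_i (s y == i)%:R * f i.
Proof.
rewrite (bigD1 (s y))//= eqxx mul1r big1 ?addr0// => i.
by rewrite eq_sym => /negbTE ->; rewrite mul0r.
Qed.

Section FiniteValued.
Context (R : realType) (dT : measure_display) (T : measurableType dT).
Variables (I : finType) (s : T -> I).
Hypothesis ms : forall i, measurable [set y | s y = i].

Lemma meas_pick_ind i : measurable_fun setT (fun y => (s y == i)%:R : R).
Proof.
rewrite (_ : (fun _ => _) = \1_[set y | s y = i]); first exact: measurable_indic.
apply/funext => y; rewrite indicE; congr (nat_of_bool _)%:R; apply/idP/idP; rewrite inE /=.
  by move/eqP.
by move=> ->.
Qed.

Lemma meas_pick (f : I -> T -> R) : (forall i, measurable_fun setT (f i)) ->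
  measurable_fun setT (fun y => f (s y) y).
Proof.
move=> mf; rewrite (_ : (fun _ => _) = fun y => \sum_i (s y == i)%:R * f i y).
  by apply: measurable_sum => i; apply: measurable_funM; [exact: meas_pick_ind|].
by apply/funext => y; rewrite (sum_pick s (f^~ y)).
Qed.

End FiniteValued.

(** * Moments, integrability and measurability on R^d *)

Section Moments.
Context (R : realType) (d : nat).
Local Notation V := 'rV[R]_d.
Local Notation X := (Rd R d).
Implicit Types (P : probability X R).

Lemma meas_dot_comp (dT : measure_display) (T : measurableType dT) (f g : T -> V) :
  (forall k, measurable_fun setT (fun t => f t ord0 k)) ->
  (forall k, measurable_fun setT (fun t => g t ord0 k)) ->
  measurable_fun setT (fun t => dot (f t) (g t)).
Proof. by move=> mf mg; apply: measurable_sum => k; exact: measurable_funM. Qed.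

Lemma meas_dotr (p : V) : measurable_fun [set: X] (fun x : X => dot p x).
Proof. by apply: meas_dot_comp => k; [exact: measurable_cst|exact: Rd_meas_coord]. Qed.

Lemma meas_dot2 : measurable_fun [set: X] (fun x : X => dot x x).
Proof. by apply: meas_dot_comp => k; exact: Rd_meas_coord. Qed.

Lemma meas_enorm : measurable_fun [set: X] (fun x : X => enorm x).
Proof.
rewrite (_ : (fun _ => _) = (fun x : X => Num.sqrt (dot x x))).
  apply: Rd_cont_meas => x; apply: (@continuous_comp _ _ _ (fun x : V => dot x x) Num.sqrt).
    rewrite /dot; apply: continuous_big => [|k _ z]; first exact: add_continuous.
    by apply: (@cvgM _ _ (nbhs z) _ (fun y : V => y ord0 k) (fun y : V => y ord0 k)); exact: coord_continuous.
  exact: sqrt_continuous.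
apply/funext => x; rewrite /enorm; congr Num.sqrt.
Qed.

Lemma meas_sqdist (dT : measure_display) (T : measurableType dT) (f g : T -> X) :
  measurable_fun setT f -> measurable_fun setT g ->
  measurable_fun setT (fun t => sqdist (f t : V) (g t : V)).
Proof.
move=> mf mg; apply: measurable_sum => k; apply: measurable_funX.
by apply: measurable_funB; [apply: (measurableT_comp (Rd_meas_coord k))..].
Qed.

Lemma meas_sqdist_prod :
  measurable_fun [set: X * X] (fun z : X * X => sqdist (z.1 : V) (z.2 : V)).
Proof. exact: (meas_sqdist measurable_fst measurable_snd). Qed.

Lemma fm2P P : finite_moment 2 P -> L1 P (fun x : X => dot x x).
Proof.
move=> h; apply: L1_ge0 => [|x|]; [exact: meas_dot2|exact: dot_ge0|].
by apply: le_lt_trans h; under [leRHS]eq_integral do rewrite enorm2.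
Qed.

Lemma L1_fm2 P : L1 P (fun x : X => dot x x) -> finite_moment 2 P.
Proof.
move=> h; rewrite /finite_moment; under eq_integral do rewrite enorm2.
by rewrite integral_E// ltry.
Qed.

Lemma fm2_fm1 P : finite_moment 2 P -> finite_moment 1 P.
Proof.
move=> /fm2P h.
have h1 : L1 P (fun x : X => enorm x).
  apply: (@L1_le _ _ _ _ _ (fun x : X => 1 + dot x x)); first exact: meas_enorm.
    move=> x; rewrite ger0_norm ?enorm_ge0// -enorm2.
    have := sqr_ge0 (enorm x - 1); have := enorm_ge0 x; nra.
  by apply: L1D => //; exact: L1_cst.
by rewrite /finite_moment; under eq_integral do rewrite expr1; rewrite integral_E// ltry.
Qed.

Lemma fm1P P : finite_moment 1 P -> L1 P (fun x : X => enorm x).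
Proof.
move=> h; apply: L1_ge0 => [|x|]; [exact: meas_enorm|exact: enorm_ge0|].
by apply: le_lt_trans h; under [leRHS]eq_integral do rewrite expr1.
Qed.

Lemma fm1_coord P k : finite_moment 1 P -> L1 P (fun x : X => (x : V) ord0 k).
Proof.
move=> /fm1P; apply: L1_le; first exact: Rd_meas_coord.
by move=> x; exact: coord_le_enorm.
Qed.

Lemma fm1_dot P p : finite_moment 1 P -> L1 P (fun x : X => dot p x).
Proof. by move=> h; apply: L1_sum => k; apply: L1Z; exact: fm1_coord. Qed.

(** By [subgradient], a finite convex function is the supremum of its supporting affine functions,
    so a strict superlevel set is a union of open superlevel sets of affine functions. *)
Lemma convex_lsc (phi : V -> R) : convex_real phi -> forall a, open [set x | a < phi x].
Proof.
move=> cphi a.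
have [p hp] := choice (subgradient cphi).
rewrite (_ : [set x | _] = \bigcup_z [set x | a < phi z + dot (p z) (x - z)]).
  apply: bigcup_open => z _.
  rewrite (_ : [set x | _] = [set x | a - phi z + dot (p z) z < dot (p z) x]).
    by apply: open_gt_continuous; exact: continuous_dot.
  by apply/seteqP; split => x /=; rewrite !dotE; lra.
apply/seteqP; split => [x /= ax|x [z _ /= h]]; last exact: lt_le_trans h (hp z x).
by exists x => //=; rewrite subrr dot0r addr0.
Qed.

Lemma convex_meas (phi : V -> R) : convex_real phi ->
  measurable_fun [set: X] (phi : X -> R).
Proof.
move=> cphi; apply/measurable_EFinP; apply: (@Rd_lsc_meas _ _ (EFin \o phi)) => a.
have := @convex_lsc phi cphi a; congr open; apply/seteqP; by split => x /=; rewrite lte_fin.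
Qed.

End Moments.

(** * Partitions of unity and semidiscrete duality *)
Section MaxAffine.
Context (R : realType) (d : nat) (I : finType) (i0 : I).
Local Notation V := 'rV[R]_d.
Local Notation X := (Rd R d).
Implicit Types (p : I -> V) (alpha : I -> R).

Definition aff p alpha (i : I) (y : V) : R := dot (p i) y - alpha i.
(** The maximum is written through [sel], so that an attaining index and its measurable dependence
    on [y] are at hand. *)
Definition amax p alpha (y : V) : R := aff p alpha (sel i0 (aff p alpha) y) y.

Lemma aff_meas p alpha i : measurable_fun [set: X] (aff p alpha i : X -> R).
Proof. by apply: measurable_funB; [exact: meas_dotr|exact: measurable_cst]. Qed.

Lemma amax_ge p alpha i y : aff p alpha i y <= amax p alpha y.
Proof. exact: sel_max. Qed.

Lemma amax_ex p alpha y : exists i, amax p alpha y = aff p alpha i y.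
Proof. by eexists. Qed.

End MaxAffine.

Section PartitionOfUnity.
Context (R : realType) (d : nat) (I : finType).
Local Notation V := 'rV[R]_d.
Local Notation X := (Rd R d).
Variable (nu : probability X R).
Hypothesis nu1 : finite_moment 1 nu.

Definition punity (h : I -> X -> R) : Prop :=
  [/\ forall i, measurable_fun setT (h i), forall i y, 0 <= h i y &
      forall y, \sum_i h i y = 1].

Definition mass (h : I -> X -> R) (i : I) : R := E nu (h i).
(** The mass times the barycentre of [h i] under [nu]. It is left unnormalized so that it is affine
    in [h] and makes sense for null pieces. *)
Definition mom (h : I -> X -> R) (i : I) : V :=
  \row_k E nu (fun y : X => h i y * (y : V) ord0 k).

Implicit Types (h : I -> X -> R) (p : I -> V) (alpha : I -> R).

Lemma punity_le1 h i y : punity h -> h i y <= 1.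
Proof.
by move=> [_ h0 h1]; rewrite -(h1 y) (bigD1 i)//= lerDl sumr_ge0.
Qed.

Lemma punity_L1 h i : punity h -> L1 nu (h i).
Proof.
move=> ph; have [mh h0 _] := ph; apply: (@L1_le _ _ _ _ _ (fun=> 1)) => //; last exact: L1_cst.
by move=> y; rewrite ger0_norm// punity_le1.
Qed.

Lemma punity_L1M h i (f : X -> R) : punity h -> L1 nu f -> L1 nu (fun y => h i y * f y).
Proof.
move=> ph hf; have [mh h0 _] := ph.
apply: (@L1_le _ _ _ _ _ (fun y => `|f y|)); last exact: L1_norm.
  by apply: measurable_funM => //; exact: L1_meas hf.
by move=> y; rewrite normrM ler_piMl// ger0_norm// punity_le1.
Qed.

Lemma mass_ge0 h i : punity h -> 0 <= mass h i.
Proof. by move=> [_ h0 _]; exact: E_ge0. Qed.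

Lemma sum_mass h : punity h -> \sum_i mass h i = 1.
Proof.
move=> ph; rewrite -E_sum; last by move=> i; exact: punity_L1.
by have [_ _ h1] := ph; under eq_E do rewrite h1; rewrite E_cst.
Qed.

Lemma mass_le1 h i : punity h -> mass h i <= 1.
Proof.
move=> ph; rewrite -(sum_mass ph) (bigD1 i)//= lerDl sumr_ge0// => j _; exact: mass_ge0.
Qed.

Lemma mom_le h i k : punity h -> `|mom h i ord0 k| <= E nu (fun y : X => `|(y : V) ord0 k|).
Proof.
move=> ph; rewrite mxE; have hk : L1 nu (fun y : X => (y : V) ord0 k) by exact: fm1_coord.
have hm := punity_L1M i ph hk.
rewrite (le_trans (le_normr_Rintegral measurableT hm))//.
apply: E_le; [exact: L1_norm..|] => y; have [_ h0 _] := ph.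
by rewrite normrM ler_piMl// ger0_norm// punity_le1.
Qed.

Lemma punity_aff_L1 h p alpha i : punity h ->
  L1 nu (fun y => h i y * aff p alpha i y).
Proof.
by move=> ph; apply: punity_L1M => //; apply: L1B; [exact: fm1_dot|exact: L1_cst].
Qed.

Lemma E_aff h p alpha i : punity h ->
  E nu (fun y => h i y * aff p alpha i y) = dot (p i) (mom h i) - alpha i * mass h i.
Proof.
move=> ph.
transitivity (E nu (fun y : X => (\sum_k p i ord0 k * (h i y * (y : V) ord0 k)) - alpha i * h i y)).
  apply: eq_E => y; rewrite /aff /dot mulrBr mulr_sumr; congr (_ - _); last by rewrite mulrC.
  by apply: eq_bigr => k _; rewrite mulrCA.
have hk k : L1 nu (fun y : X => p i ord0 k * (h i y * (y : V) ord0 k)).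
  by apply: L1Z; apply: punity_L1M => //; exact: fm1_coord.
rewrite E_B; [|exact: L1_sum|apply: L1Z; exact: punity_L1].
rewrite E_sum// (E_Z (alpha i)); last exact: punity_L1.
congr (_ - _); apply: eq_bigr => k _; rewrite mxE E_Z//.
by apply: punity_L1M => //; exact: fm1_coord.
Qed.

Lemma E_punity_aff h p alpha : punity h ->
  E nu (fun y => \sum_i h i y * aff p alpha i y) =
  \sum_i (dot (p i) (mom h i) - alpha i * mass h i).
Proof.
move=> ph; rewrite E_sum; last by move=> i; exact: punity_aff_L1.
by apply: eq_bigr => i _; exact: E_aff.
Qed.

Lemma punity_pick (s : X -> I) : (forall i, measurable [set y | s y = i]) ->
  punity (fun i y => (s y == i)%:R).
Proof.
move=> ms; split => [i|i y|y]; [exact: meas_pick_ind|exact: ler0n|].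
have := @sum_pick R _ _ s (fun=> 1) y; under eq_bigr do rewrite mulr1.
by move=> <-.
Qed.

Lemma punity_cst (w : I -> R) : (forall i, 0 <= w i) -> \sum_i w i = 1 ->
  punity (fun i _ => w i).
Proof. by move=> w0 w1; split. Qed.

Lemma mass_cst (w : I -> R) i : mass (fun i _ => w i) i = w i.
Proof. exact: E_cst. Qed.

Definition bary : V := \row_k E nu (fun y : X => (y : V) ord0 k).

Lemma mom_cst (w : I -> R) i : mom (fun i _ => w i) i = w i *: bary.
Proof. by apply/rowP => k; rewrite !mxE E_Z//; exact: fm1_coord. Qed.

Definition hmix (t : R) h h' (i : I) (y : X) : R := (1 - t) * h i y + t * h' i y.

Lemma punity_mix t h h' : 0 <= t <= 1 -> punity h -> punity h' -> punity (hmix t h h').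
Proof.
move=> /andP[t0 t1] [mh h0 h1] [mh' h0' h1']; split => [i|i y|y].
- by apply: measurable_funD; apply: measurable_funM.
- by rewrite addr_ge0// mulr_ge0// subr_ge0.
- by rewrite big_split/= -!mulr_sumr h1 h1' !mulr1 subrK.
Qed.

Lemma mass_mix t h h' i : punity h -> punity h' ->
  mass (hmix t h h') i = (1 - t) * mass h i + t * mass h' i.
Proof.
move=> ph ph'; rewrite /mass /hmix E_D ?E_Z//; try apply: L1Z; exact: punity_L1.
Qed.

Lemma mom_mix t h h' i : punity h -> punity h' ->
  mom (hmix t h h') i = (1 - t) *: mom h i + t *: mom h' i.
Proof.
move=> ph ph'; apply/rowP => k; rewrite !mxE.
have hk : L1 nu (fun y : X => (y : V) ord0 k) by exact: fm1_coord.
rewrite -!E_Z; [|exact: punity_L1M..].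
rewrite -E_D; [|apply: L1Z; exact: punity_L1M..].
by apply: eq_E => y; rewrite /hmix; ring.
Qed.

End PartitionOfUnity.

(** * Semidiscrete duality by quadratic penalization *)

Section Core.
Context (R : realType) (d : nat) (I : finType) (i0 : I).
Local Notation V := 'rV[R]_d.
Local Notation X := (Rd R d).
Variables (nu : probability X R) (m : I -> R) (x : I -> V).
Hypotheses (nu1 : finite_moment 1 nu) (m0 : forall i, 0 < m i) (m1 : \sum_i m i = 1).

(** The cost of moving atoms of mass [m i] from [x i] to [v i / m i], plus [s] times the squared
    mass defects. Dividing by the prescribed [m i], not by the actual mass [a i], keeps [F]
    quadratic in [(a, v)]. *)
Let F (s : R) (a : I -> R) (v : I -> V) : R :=
  \sum_i m i * sqdist (x i) ((m i)^-1 *: v i) + s * \sum_i (m i - a i) ^+ 2.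

(** As [F] is quadratic, the expansion in [t] is exact. With p_i = 2 (x_i - v_i / m_i) and alpha_i =
    -2 s (m_i - a_i), the first-order term is -t times the variation of int sum_i h_i (p_i.y -
    alpha_i) dnu. *)
Let F_expand s t (a a' : I -> R) (v v' : I -> V) :
  F s (fun i => (1 - t) * a i + t * a' i) (fun i => (1 - t) *: v i + t *: v' i) =
  F s a v
  - t * \sum_i (dot (2 *: (x i - (m i)^-1 *: v i)) (v' i - v i)
                + 2 * s * (m i - a i) * (a' i - a i))
  + t ^+ 2 * \sum_i (dot (v' i - v i) (v' i - v i) / m i + s * (a' i - a i) ^+ 2).
Proof.
rewrite /F !mulr_sumr -!big_split -sumrB -big_split /=; apply: eq_bigr => i _.
have mi : m i != 0 by rewrite gt_eqF.
rewrite !sqdistE !dotE (dotC (v' i) (v i)).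
by field.
Qed.

Let F_ge0 s a v : 0 <= s -> 0 <= F s a v.
Proof.
move=> s0; rewrite addr_ge0 ?sumr_ge0// => [i _|].
  by rewrite mulr_ge0 ?sqdist_ge0// ltW.
by rewrite mulr_ge0// sumr_ge0// => i _; exact: sqr_ge0.
Qed.

Let m_min : exists2 c, 0 < c & forall i, c <= m i.
Proof.
have [i _ hi] := @arg_minP _ _ _ i0 xpredT m isT.
by exists (m i) => // j; exact: hi.
Qed.

(** Each coordinate of a moment is bounded by the first absolute moment of [nu] in that coordinate.
    The bound is uniform over partitions, so it controls the second-order term of every
    variation. *)
Let mom_diff_bound (h h' : I -> X -> R) i : punity h -> punity h' ->
  dot (mom nu h' i - mom nu h i) (mom nu h' i - mom nu h i) <=
  \sum_(k < d) 4 * E nu (fun y : X => `|(y : V) ord0 k|) ^+ 2.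
Proof.
move=> ph ph'; apply: ler_sum => k _.
have -> : (mom nu h' i - mom nu h i) ord0 k = mom nu h' i ord0 k - mom nu h i ord0 k.
  by rewrite [LHS]mxE [in X in _ + X = _]mxE.
rewrite -expr2.
have := mom_le nu1 i k ph; have := mom_le nu1 i k ph'.
rewrite !ler_norml => /andP[h1 h2] /andP[h3 h4].
set M := E _ _ in h1 h2 h3 h4 *.
set u := mom nu h' i _ _ in h1 h2 *; set w := mom nu h i _ _ in h3 h4 *.
have h5 : 0 <= 2 * M - (u - w) by lra.
have h6 : 0 <= 2 * M + (u - w) by lra.
have := mulr_ge0 h5 h6; nra.
Qed.

(** An infimum is only approached, at the price [delta]. The last bound compares with the constant
    partition [m], which has no mass defect; it does not depend on [s], so that [s] can be chosen
    from it. *)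
Let near_min s (delta : R) : 0 <= s -> 0 < delta -> exists h : I -> X -> R, [/\ punity h,
  forall h' : I -> X -> R, punity h' -> F s (mass nu h) (mom nu h) <= F s (mass nu h') (mom nu h') + delta &
  F s (mass nu h) (mom nu h) <= F 0 m (fun i => m i *: bary nu) + delta].
Proof.
move=> s0 d0.
pose S := [set r | exists2 h, punity h & r = F s (mass nu h) (mom nu h)].
have pm : punity (fun i (_ : X) => m i) by apply: punity_cst => // i; exact: ltW.
have S0 : S !=set0 by exists (F s (mass nu (fun i _ => m i)) (mom nu (fun i _ => m i))); eexists; [exact: pm|].
have lS : has_lbound S by exists 0 => _ [h _ ->]; exact: F_ge0.
have [r [h ph rE] rlt] := inf_adherent d0 (conj S0 lS).
have hle h' : punity h' -> F s (mass nu h) (mom nu h) <= F s (mass nu h') (mom nu h') + delta.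
  move=> ph'; rewrite -rE (le_trans (ltW rlt))// lerD2r.
  by apply: ge_inf => //; exists h'.
exists h; split => //; apply: le_trans (hle _ pm) _; rewrite lerD2r le_eqVlt; apply/orP; left.
apply/eqP; rewrite /F; congr (_ + _).
  by apply: eq_bigr => i _; rewrite mom_cst.
rewrite mul0r big1 ?mulr0// => i _; by rewrite mass_cst subrr expr0n.
Qed.

Let sqdist_convex (u w z : V) t : 0 <= t <= 1 ->
  sqdist u ((1 - t) *: w + t *: z) <= (1 - t) * sqdist u w + t * sqdist u z.
Proof.
move=> /andP[t0 t1]; have := sqdist_ge0 w z; rewrite !sqdistE !dotE (dotC z w).
have := mulr_ge0 t0 (_ : 0 <= 1 - t); rewrite subr_ge0 => /(_ t1); nra.
Qed.

(** The reverse of weak duality, up to [eps], for a source with atoms [x i] of mass [m i]. The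
    subtraction of |p_i|^2/4 is the effect of [Q2] on an affine function of slope [p i]. *)
Lemma semidiscrete_duality eps : 0 < eps -> exists (h : I -> X -> R) (z p : I -> V) (alpha : I -> R),
  [/\ punity h, forall i, mass nu h i = m i, forall i, mom nu h i = m i *: z i &
    \sum_i m i * sqdist (x i) (z i) + E nu (amax i0 p alpha) <=
    \sum_i m i * (aff p alpha i (x i) - dot (p i) (p i) / 4) + eps].
Proof.
move=> e0.
(* The penalty weight s forces |m_i - mass_i| <= tau m_i, so that mixing with
   the constant partition w in proportion tau restores the masses at a cost
   tau C; t is the step of the variation towards the selection h'. *)
have [c c0 cm] := m_min.
set b := bary nu.
pose F0 := F 0 m (fun i => m i *: b).
have F00 : 0 <= F0 by exact: F_ge0.
(* Bounds the cost of the constant partition [w], whose moments are [w i *: b] with [w i <= 1]. *)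
pose C := \sum_i 2 * (m i * dot (x i) (x i) + dot b b / m i).
have C0 : 0 <= C.
  apply: sumr_ge0 => i _; rewrite mulr_ge0// addr_ge0//.
    by rewrite mulr_ge0 ?dot_ge0// ltW.
  by rewrite divr_ge0 ?dot_ge0// ltW.
pose tau := eps / (2 * C + 2 * eps).
have den : 0 < 2 * C + 2 * eps by lra.
have tau0 : 0 < tau by rewrite divr_gt0.
have tau1 : tau <= 1 by rewrite ler_pdivrMr// mul1r; lra.
have tauC : tau * C <= eps / 2.
  by rewrite mulrAC ler_pdivrMr//; nra.
have tc : 0 < tau * c by rewrite mulr_gt0.
(* A near-minimizer up to [t ^+ 2 <= 1] has value at most [F0 + 1], so this weight forces the sum of
   squared defects below [(tau * c) ^+ 2]. *)
pose s := (F0 + 1) / (tau * c) ^+ 2.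
have s0 : 0 < s by rewrite divr_gt0 ?exprn_gt0//; lra.
(* Bounds the second-order coefficient of [F_expand] for every competing partition. *)
pose B := \sum_(i : I) ((\sum_(k < d) 4 * E nu (fun y : X => `|(y : V) ord0 k|) ^+ 2) / m i + s).
have B0 : 0 <= B.
  apply: sumr_ge0 => i _; rewrite addr_ge0 ?(ltW s0)// divr_ge0 ?(ltW (m0 i))//.
  by apply: sumr_ge0 => k _; rewrite mulr_ge0// sqr_ge0.
(* Near-minimality up to [t ^+ 2] and the second-order term [t ^+ 2 * B] leave, after division by
   [t], an error [t * (1 + B) <= eps / 2]. *)
pose t := eps / (2 * (1 + B) + eps).
have den2 : 0 < 2 * (1 + B) + eps by lra.
have t0 : 0 < t by rewrite divr_gt0.
have t1 : t <= 1 by rewrite ler_pdivrMr// mul1r; lra.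
have tB : t * (1 + B) <= eps / 2 by rewrite mulrAC ler_pdivrMr//; nra.
have t20 : 0 < t ^+ 2 by rewrite exprn_gt0.
have [h [ph hmin hF0]] := near_min (ltW s0) t20.
pose a := mass nu h; pose v := mom nu h.
pose z i := (m i)^-1 *: v i.
pose p i := 2 *: (x i - z i).
pose alpha i := - (2 * s * (m i - a i)).
pose h' (i : I) (y : X) : R := (sel i0 (aff p alpha) y == i)%:R.
have ph' : punity h' by apply: punity_pick => i; apply: sel_meas => j; exact: aff_meas.
pose a' := mass nu h'; pose v' := mom nu h'.
have EA : E nu (amax i0 p alpha) = \sum_i (dot (p i) (v' i) - alpha i * a' i).
  rewrite -E_punity_aff//; apply: eq_E => y.
  exact: (sum_pick (sel i0 (aff p alpha)) (fun i => aff p alpha i y) y).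
have t01 : 0 <= t <= 1 by rewrite (ltW t0) t1.
have lin : \sum_i (dot (p i) (v' i - v i) + 2 * s * (m i - a i) * (a' i - a i)) <= eps / 2.
  have := hmin _ (punity_mix t01 ph ph').
  have -> : mass nu (hmix t h h') = fun i => (1 - t) * a i + t * a' i.
    by apply/funext => i; rewrite mass_mix.
  have -> : mom nu (hmix t h h') = fun i => (1 - t) *: v i + t *: v' i.
    by apply/funext => i; rewrite mom_mix.
  rewrite F_expand -/a -/v; set Lin := \sum_i _; set Q := \sum_i _.
  have QB : Q <= B.
    apply: ler_sum => i _; apply: lerD.
      by rewrite ler_pM2r ?invr_gt0//; exact: mom_diff_bound.
    rewrite ger_pMr//; have := mass_ge0 nu i ph; have := mass_ge0 nu i ph'.
    have := mass_le1 nu i ph; have := mass_le1 nu i ph'; rewrite -/(a i) -/(a' i); nra.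
  move=> h1; apply: le_trans tB; rewrite -(ler_pM2l t0).
  have : t ^+ 2 * Q <= t ^+ 2 * B by rewrite ler_pM2l.
  rewrite expr2; nra.
(* The solution of [(1 - tau) * a i + tau * w i = m i]. It is nonnegative because the defects are at
   most [tau * m i]. *)
pose w i := m i + (1 - tau) * (m i - a i) / tau.
have sq_small : \sum_i (m i - a i) ^+ 2 <= (tau * c) ^+ 2.
  have h1 : s * \sum_i (m i - a i) ^+ 2 <= F0 + 1.
    have h2 : F s a v <= F0 + 1.
      apply: le_trans hF0 _; rewrite lerD2l.
      by rewrite exprn_ile1// ltW.
    apply: le_trans h2; rewrite /F lerDr sumr_ge0// => i _.
    by rewrite mulr_ge0 ?sqdist_ge0// ltW.
  move: h1; rewrite /s mulrAC ler_pdivrMr ?exprn_gt0// ler_pM2l//; lra.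
have ma i : `|m i - a i| <= tau * m i.
  apply: (@le_trans _ _ (tau * c)); last by rewrite ler_pM2l.
  rewrite -(@ler_pXn2r _ 2%N) ?nnegrE ?(ltW tc)// real_normK ?num_real//.
  apply: le_trans sq_small; rewrite (bigD1 i)//= lerDl sumr_ge0// => j _; exact: sqr_ge0.
have w0 i : 0 <= w i.
  rewrite /w -[m i]/(m i) -(mulrK (unitf_gt0 tau0) (m i)) -mulrDl divr_ge0 ?(ltW tau0)//.
  rewrite (mulrK (unitf_gt0 tau0) (m i)).
  have := ma i; rewrite ler_norml => /andP[h1 h2].
  have := m0 i; nra.
have w1 : \sum_i w i = 1.
  rewrite big_split/= m1 -mulr_suml -mulr_sumr sumrB m1 (sum_mass nu ph) subrr.
  by rewrite mulr0 mul0r addr0.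
have wle1 i : w i <= 1 by rewrite -w1 (bigD1 i)//= lerDl sumr_ge0.
have pw : punity (fun i (_ : X) => w i) by exact: punity_cst.
have tau01 : 0 <= tau <= 1 by rewrite (ltW tau0) tau1.
pose h2 := hmix tau h (fun i _ => w i).
pose z2 i := (m i)^-1 *: mom nu h2 i.
exists h2, z2, p, alpha; split.
- exact: punity_mix.
- move=> i; rewrite mass_mix// mass_cst /w -/(a i); field; lra.
- by move=> i; rewrite /z2 scalerA divff ?gt_eqF// scale1r.
have Z2 : \sum_i m i * sqdist (x i) (z2 i) <= \sum_i m i * sqdist (x i) (z i) + tau * C.
  rewrite mulr_sumr -big_split/=; apply: ler_sum => i _.
  have -> : z2 i = (1 - tau) *: z i + tau *: ((w i / m i) *: b).
    rewrite /z2 /z mom_mix// mom_cst// -/b -/(v i) scalerDr !scalerA.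
    by congr (_ *: _ + _ *: _); ring.
  have h1 := sqdist_convex (x i) (z i) ((w i / m i) *: b) tau01.
  have h3 : m i * sqdist (x i) ((w i / m i) *: b) <=
     2 * (m i * dot (x i) (x i) + dot b b / m i).
    have h4 : sqdist (x i) ((w i / m i) *: b) <= 2 * (dot (x i) (x i) + (w i / m i) ^+ 2 * dot b b).
      have := dot_ge0 (x i + (w i / m i) *: b); rewrite sqdistE !dotE (dotC b (x i)); lra.
    have h5 : m i * ((w i / m i) ^+ 2 * dot b b) <= dot b b / m i.
      have -> : m i * ((w i / m i) ^+ 2 * dot b b) = (w i ^+ 2) * (dot b b / m i).
        by have := m0 i => mi; field; rewrite gt_eqF.
      by rewrite ler_piMl ?exprn_ile1// divr_ge0 ?dot_ge0// ltW.
    have := m0 i; nra.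
  have h6 := sqdist_ge0 (x i) (z i); have mi := m0 i.
  apply: (@le_trans _ _ (m i * ((1 - tau) * sqdist (x i) (z i) + tau * sqdist (x i) ((w i / m i) *: b)))).
    by rewrite ler_pM2l.
  have h7 : tau * (m i * sqdist (x i) ((w i / m i) *: b)) <=
     tau * (2 * (m i * dot (x i) (x i) + dot b b / m i)) by rewrite ler_pM2l.
  have h8 : 0 <= tau * (m i * sqdist (x i) (z i)) by rewrite mulr_ge0 ?(ltW tau0)// mulr_ge0// ltW.
  lra.
(* Since [p i = 2 *: (x i - z i)], the terms in [p i] recombine into the cost, and [alpha] turns the
   mass defects into a nonnegative term, dropped at the end. *)
have J : \sum_i m i * (aff p alpha i (x i) - dot (p i) (p i) / 4) =
  \sum_i m i * sqdist (x i) (z i) + 2 * s * \sum_i (m i - a i) ^+ 2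
  + \sum_i (dot (p i) (v i) - alpha i * a i).
  rewrite mulr_sumr -!big_split/=; apply: eq_bigr => i _.
  have -> : v i = m i *: z i by rewrite /z scalerA divff ?gt_eqF// scale1r.
  rewrite /aff /alpha /p !sqdistE !dotE (dotC (v i) (x i)).
  by field; rewrite gt_eqF.
have EA2 : \sum_i (dot (p i) (v' i) - alpha i * a' i) =
  \sum_i (dot (p i) (v' i - v i) + 2 * s * (m i - a i) * (a' i - a i)) +
  \sum_i (dot (p i) (v i) - alpha i * a i).
  by rewrite -big_split/=; apply: eq_bigr => i _; rewrite dotDr dotNr /alpha; ring.
have sq0 : 0 <= 2 * s * \sum_i (m i - a i) ^+ 2.
  by rewrite mulr_ge0 ?sumr_ge0// => [|j _]; [lra|exact: sqr_ge0].
rewrite EA EA2 J; lra.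
Qed.

End Core.

(** * Quantization *)
Section LimitLemmas.
Context (R : realType) (dT : measure_display) (T : measurableType dT).
Variable P : probability T R.

Lemma E_dominated_small (f_ : nat -> T -> R) (g : T -> R) eps : 0 < eps ->
  (forall n, measurable_fun setT (f_ n)) -> (forall n x, 0 <= f_ n x <= g x) ->
  L1 P g -> (forall x e, 0 < e -> exists N, forall n, (N <= n)%N -> f_ n x <= e) ->
  exists n, E P (f_ n) <= eps.
Proof.
move=> e0 mf fg Lg fto0; apply: contrapT => /forallNP hn.
have Lf n : L1 P (f_ n).
  by apply: L1_le Lg => // x; have /andP[h1 h2] := fg n x; rewrite ger0_norm.
have cv : (\int[P]_x (f_ n x)%:E @[n --> \oo] --> \int[P]_x (cst 0 x : \bar R))%E.
  apply: (@dominated_cvg _ _ _ P setT measurableT (fun n x => (f_ n x)%:E) (cst 0%E) (fun x => (g x)%:E)) => //.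
  - by move=> n; exact/measurable_EFinP.
  - move=> x _; apply/cvg_EFin; first exact: nearW.
    apply/cvgrPdist_le => e e0'; have [N hN] := fto0 x e e0'.
    exists N => // n /= Nn; rewrite sub0r normrN /=.
    by have /andP[h1 h2] := fg n x; rewrite ger0_norm// hN.
  - by move=> n x _; rewrite /= lee_fin; have /andP[h1 h2] := fg n x; rewrite ger0_norm.
have : (eps%:E <= \int[P]_x (cst 0 x : \bar R))%E.
  rewrite -(cvg_lim _ cv)//; apply: lime_ge; first by apply/cvg_ex; eexists; exact: cv.
  apply: nearW => n; rewrite integral_E// lee_fin ltW// ltNge; apply/negP; exact: hn.
by rewrite integral0 lee_fin leNgt e0.
Qed.

Lemma E_mul_null (h f : T -> R) : (forall x, 0 <= h x) -> L1 P h -> E P h = 0 ->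
  measurable_fun setT f -> E P (fun x => h x * f x) = 0.
Proof.
move=> h0 Lh Eh mf.
have mh := L1_meas Lh.
have ae : ae_eq P setT (EFin \o h) (cst 0%E).
  apply/ae_eq_integral_abs => //; first exact/measurable_EFinP.
  by under eq_integral do rewrite /= ger0_norm//; rewrite integral_E// Eh.
rewrite /E /Rintegral (@ae_eq_integral _ _ _ P setT (cst 0%E))//.
- by rewrite integral0.
- by apply/measurable_EFinP; exact: measurable_funM.
- apply: filterS ae => x /= hx _; have [->] := hx I; by rewrite mul0r.
Qed.

End LimitLemmas.

Section Quantization.
Context (R : realType) (d : nat).
Local Notation V := 'rV[R]_d.
Local Notation X := (Rd R d).
Variable (mu : probability X R).
Hypothesis mu2 : finite_moment 2 mu.

(** An enumeration of the rational vectors starting at 0, so that the distance to the nearest of the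
    first points is dominated by |x|. Integers that are not codes are sent to 0 as well. *)
Let r (n : nat) : V :=
  if n is n'.+1 then
    if unpickle n' : option 'rV[rat]_d is Some q then \row_k ratr (q ord0 k) else 0
  else 0.

Let r_dense (x : V) (e : R) : 0 < e -> exists n, sqdist x (r n) <= e.
Proof.
(* The tolerance per coordinate satisfies [e' <= 1], so its square is at most [e'], and [d] of them
   add up to at most [e]. *)
move=> e0; pose e' := e / (d%:R + 1 + e).
have d0 : 0 <= (d%:R : R) by exact: ler0n.
have den : 0 < d%:R + 1 + e by lra.
have e'0 : 0 < e' by rewrite divr_gt0.
have hq k : exists q : rat, x ord0 k - e' < (ratr q : R) < x ord0 k.
  have xr : x ord0 k - e' < x ord0 k by rewrite ltrBlDr ltrDl.
  by have [q] := rat_in_itvoo xr; rewrite in_itv/=; exists q.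
have [q hq'] := choice hq.
exists (pickle (\row_k q k)).+1; rewrite /r pickleK.
apply: (@le_trans _ _ (\sum_(k < d) e')).
  apply: ler_sum => k _; rewrite !mxE; have /andP[h1 h2] := hq' k.
  have e1 : e' <= 1 by rewrite ler_pdivrMr// mul1r; lra.
  nra.
rewrite sumr_const card_ord -mulr_natl mulrA ler_pdivrMr//; nra.
Qed.

Lemma E_pick (I : finType) (s : X -> I) i : (forall i, measurable [set y | s y = i]) ->
  L1 mu (fun y => (s y == i)%:R).
Proof. by move=> ms; exact: (punity_L1 mu i (punity_pick ms)). Qed.

(** Dominated convergence: the squared distance to the nearest of the first n points of a dense
    sequence tends to 0 and is at most |x|^2. Some cells may still be null. *)
Lemma quantization_null eps : 0 < eps ->
  exists (I : finType) (s : X -> I) (c : I -> V),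
  (forall i, measurable [set y | s y = i]) /\
  E mu (fun x : X => sqdist (x : V) (c (s x))) <= eps.
Proof.
move=> e0.
(* The nearest of the first n points maximizes the affine functions 2 r_i.x - |r_i|^2. *)
pose p n (i : 'I_n.+1) : V := 2 *: r i.
pose al n (i : 'I_n.+1) : R := dot (r i) (r i).
pose s n (x : X) : 'I_n.+1 := sel ord0 (aff (p n) (al n)) x.
have sE n (x : V) : sqdist x (r (s n x)) = dot x x - amax ord0 (p n) (al n) x.
  by rewrite sqdistE /amax /aff /p /al -/(s n x) !dotE (dotC _ x); ring.
have sle n j (x : V) : (j <= n)%N -> sqdist x (r (s n x)) <= sqdist x (r j).
  move=> jn; have := amax_ge ord0 (p n) (al n) (Ordinal (jn : (j < n.+1)%N)) x.
  by rewrite sE sqdistE /aff /p /al /= !dotE (dotC (r j) x); lra.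
have ms n i : measurable [set y | s n y = i] by apply: sel_meas => j; exact: aff_meas.
have := @E_dominated_small _ _ _ mu (fun n (x : X) => sqdist (x : V) (r (s n x)))
  (fun x : X => dot x x) eps e0.
case.
- move=> n; apply: (@meas_pick _ _ _ _ _ (ms n) (fun i (x : X) => sqdist (x : V) (r i))) => i.
  apply: (@meas_sqdist _ _ _ _ (fun x : X => x) (fun=> r i : X)); first exact: measurable_id.
  exact: measurable_cst.
- move=> n x; rewrite sqdist_ge0/= (le_trans (sle n 0%N x _))//.
  by rewrite (_ : r 0%N = 0)// sqdistE !dot0r; lra.
- exact: fm2P.
- move=> x e e1; have [N hN] := r_dense x e1; exists N => n Nn.
  exact: le_trans (sle _ _ _ Nn) hN.
move=> n hn; exists ('I_n.+1 : finType), (s n), (fun i : 'I_n.+1 => r i).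
by split => [i|]; [exact: ms|exact: hn].
Qed.

(* Points of null cells are reassigned to a fixed cell of positive mass. *)
Lemma quantization eps : 0 < eps ->
  exists (I : finType) (i0 : I) (s : X -> I) (c : I -> V),
  [/\ (forall i, measurable [set y | s y = i]),
      (forall i, 0 < mass mu (fun i y => (s y == i)%:R) i) &
      E mu (fun x : X => sqdist (x : V) (c (s x))) <= eps].
Proof.
move=> e0; have [I [s [c [ms hs]]]] := quantization_null e0.
pose m i := mass mu (fun i y => (s y == i)%:R) i.
have pm := punity_pick ms.
have m0 i : 0 <= m i by exact: mass_ge0.
have [i0 mi0] : exists i0, 0 < m i0.
  apply: contrapT => /forallNP h.
  have := sum_mass mu pm; rewrite big1 => [/eqP|i _]; first by rewrite eq_sym oner_eq0.
  apply/eqP; rewrite eq_le m0 andbT leNgt; apply/negP; exact: h.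
pose J : finType := {i : I | 0 < m i}.
pose j0 : J := exist _ i0 mi0.
pose s' x : J := insubd j0 (s x).
have ms' j : measurable [set y | s' y = j].
  have mf := fun k => ms k.
  rewrite (_ : [set y | _] = \bigcup_(i in [set i | insubd j0 i = j]) [set y | s y = i]).
    by apply: fin_bigcup_measurable => //; exact: finite_finset.
  apply/seteqP; split => [y /= h|y [i /= h sy]]; first by exists (s y).
  by rewrite /s' sy.
exists J, j0, s', (fun j => c (val j)); split => //.
  move=> j; apply: (@lt_le_trans _ _ (m (val j))); first exact: (valP j).
  apply: E_le; [exact: (punity_L1 mu (val j) pm)|exact: (punity_L1 mu j (punity_pick ms'))|].
  move=> x; rewrite ler_nat; case: eqP => // sx.
  have -> : s' x == j by apply/eqP/val_inj; rewrite /s' sx valKd.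
  by [].
have L k : L1 mu (fun x : X => sqdist (x : V) (c k)).
  have -> : (fun x : X => sqdist (x : V) (c k)) = fun x : X => (dot x x - dot (2 *: c k) x) + dot (c k) (c k).
    by apply/funext => x; rewrite sqdistE dotZl (dotC x).
  apply: L1D; last exact: L1_cst.
  by apply: L1B; [exact: fm2P|apply: fm1_dot; exact: fm2_fm1].
have Lp (U : finType) (u : X -> U) (e : U -> I) : (forall i, measurable [set y | u y = i]) ->
    L1 mu (fun x : X => sqdist (x : V) (c (e (u x)))).
  move=> mu'; have pu := punity_pick mu'.
  rewrite (_ : (fun _ => _) = fun x : X => \sum_i (u x == i)%:R * sqdist (x : V) (c (e i))).
    by apply: L1_sum => i; exact: (punity_L1M i pu (L _)).
  by apply/funext => x; rewrite (@sum_pick R _ _ u (fun i => sqdist (x : V) (c (e i)))).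
(* Bounds the extra error on reassigned points. It lives on null cells, so its expectation is 0. *)
pose g x : R := \sum_(i | ~~ (0 < m i)) (s x == i)%:R * sqdist x (c i0).
have Lg : L1 mu g by apply: L1_sum => i; exact: (punity_L1M i pm (L _)).
have Eg : E mu g = 0.
  rewrite E_sum; last by move=> i; exact: (punity_L1M i pm (L _)).
  rewrite big1// => i mi; apply: E_mul_null => //; first exact: E_pick.
    apply/eqP; rewrite eq_le m0 andbT leNgt; exact: mi.
  exact: L1_meas (L i0).
apply: le_trans hs.
have <- : E mu (fun x : X => sqdist (x : V) (c (s x)) + g x) = E mu (fun x : X => sqdist (x : V) (c (s x))).
  by rewrite E_D ?Eg ?addr0//; exact: (Lp _ s id ms).
apply: E_le; first exact: (Lp _ s' val ms').
  by apply: L1D => //; exact: (Lp _ s id ms).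
move=> x; rewrite /s' val_insubd; have [mi|mi] := boolP (0 < m (s x)).
  by rewrite lerDl sumr_ge0// => i _; rewrite mulr_ge0 ?sqdist_ge0.
rewrite /g (bigD1 (s x))//= eqxx mul1r addrCA lerDl addr_ge0 ?sqdist_ge0//.
by rewrite sumr_ge0// => i _; rewrite mulr_ge0 ?sqdist_ge0.
Qed.

End Quantization.

(** * Couplings and the convex order *)
(** The minorant makes the integral of the negative part finite; an infinite integral of the
    positive part would then make the whole integral infinite. *)
Lemma integrable_lower_bound (R : realType) (dT : measure_display)
    (T : measurableType dT) (P : probability T R) (f : T -> \bar R) (l : T -> R) :
  measurable_fun setT f -> L1 P l -> (forall x, (l x)%:E <= f x)%E ->
  (\int[P]_x f x < +oo)%E -> P.-integrable setT f.
Proof.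
move=> mf Ll lf h.
have mn := measurable_funeneg mf.
have mp := measurable_funepos mf.
have fn : (\int[P]_x f^\- x < +oo)%E.
  have := integral_funeneg_lt_pinfty measurableT Ll; apply: le_lt_trans.
  apply: ge0_le_integral => //.
    by apply: measurable_funeneg; exact: measurable_int Ll.
  by move=> x _; apply: (@funeneg_le _ _ setT) => [y _|]; [exact: lf|rewrite inE].
have fp : (\int[P]_x f^\+ x < +oo)%E.
  rewrite ltey; apply/eqP => fp; move: h; rewrite integralE fp.
  have : (\int[P]_x f^\- x)%E \is a fin_num by rewrite ge0_fin_numE// integral_ge0.
  by move=> /fineK <-; rewrite addye.
apply/integrableP; split => //.
rewrite -[fun x => _]/(abse \o f) fune_abse ge0_integralD//.
exact: lte_add_pinfty.
Qed.

Section Marginals.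
Context (R : realType) (d : nat).
Local Notation V := 'rV[R]_d.
Local Notation X := (Rd R d).
Implicit Types (mu eta : probability X R) (pi : probability (X * X)%type R).

Lemma coupling_fst mu eta pi (g : X -> \bar R) : coupling mu eta pi ->
  measurable_fun setT g -> (\int[pi]_z g z.1 = \int[mu]_x g x)%E.
Proof.
move=> [c1 _] mg; rewrite -(integral_push pi measurable_fst mg).
apply: eq_prob_integral => A mA; rewrite pushE -c1//.
by congr (pi _); apply/seteqP; split => z //= [].
Qed.

Lemma coupling_snd mu eta pi (g : X -> \bar R) : coupling mu eta pi ->
  measurable_fun setT g -> (\int[pi]_z g z.2 = \int[eta]_x g x)%E.
Proof.
move=> [_ c2] mg; rewrite -(integral_push pi measurable_snd mg).
apply: eq_prob_integral => A mA; rewrite pushE -c2//.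
by congr (pi _); apply/seteqP; split => z //= [].
Qed.

Lemma coupling_integrable_fst mu eta pi (g : X -> \bar R) : coupling mu eta pi ->
  mu.-integrable setT g -> pi.-integrable setT (fun z => g z.1).
Proof.
move=> c /integrableP[mg h]; apply/integrableP; split.
  exact: (measurableT_comp mg measurable_fst).
by rewrite (coupling_fst c (g := fun x => `|g x|%E))//; exact: measurableT_comp.
Qed.

Lemma coupling_integrable_snd mu eta pi (g : X -> \bar R) : coupling mu eta pi ->
  eta.-integrable setT g -> pi.-integrable setT (fun z => g z.2).
Proof.
move=> c /integrableP[mg h]; apply/integrableP; split.
  exact: (measurableT_comp mg measurable_snd).
by rewrite (coupling_snd c (g := fun x => `|g x|%E))//; exact: measurableT_comp.
Qed.

Lemma coupling_E_fst mu eta pi (g : X -> R) : coupling mu eta pi -> L1 mu g ->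
  L1 pi (fun z => g z.1) /\ E pi (fun z => g z.1) = E mu g.
Proof.
move=> c Lg; split; first exact: (coupling_integrable_fst c Lg).
by rewrite /E /Rintegral; congr fine; apply: (coupling_fst c); exact: measurable_int Lg.
Qed.

Lemma coupling_E_snd mu eta pi (g : X -> R) : coupling mu eta pi -> L1 eta g ->
  L1 pi (fun z => g z.2) /\ E pi (fun z => g z.2) = E eta g.
Proof.
move=> c Lg; split; first exact: (coupling_integrable_snd c Lg).
by rewrite /E /Rintegral; congr fine; apply: (coupling_snd c); exact: measurable_int Lg.
Qed.

Lemma coupling_cost_L1 pi : (\int[pi]_z (sqdist (z.1 : V) (z.2 : V))%:E < +oo)%E ->
  L1 pi (fun z : X * X => sqdist (z.1 : V) (z.2 : V)).
Proof. by apply: L1_ge0; [exact: meas_sqdist_prod|move=> z; exact: sqdist_ge0]. Qed.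

(** By |x|^2 <= 2 |x - y|^2 + 2 |y|^2. Hence a measure at finite distance from one in P_2 lies in
    P_2. *)
Lemma coupling_fm2 mu eta pi : coupling mu eta pi -> finite_moment 2 eta ->
  (\int[pi]_z (sqdist (z.1 : V) (z.2 : V))%:E < +oo)%E -> finite_moment 2 mu.
Proof.
move=> c /fm2P he /coupling_cost_L1 Lc; apply: L1_fm2.
have [L2 _] := coupling_E_snd c he.
have L : L1 pi (fun z : X * X => 2 * sqdist (z.1 : V) (z.2 : V) + 2 * dot z.2 z.2).
  by apply: L1D; exact: L1Z.
apply: L1_ge0 => [|x|]; [exact: meas_dot2|exact: dot_ge0|].
rewrite -(coupling_fst c); last by apply/measurable_EFinP; exact: meas_dot2.
have := ltry (E pi (fun z : X * X => 2 * sqdist (z.1 : V) (z.2 : V) + 2 * dot z.2 z.2)).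
rewrite -integral_E//; apply: le_lt_trans; apply: integral_mono.
- apply: measurableT_comp => //; exact: (measurableT_comp (@meas_dot2 R d) measurable_fst).
- by apply/measurable_EFinP; exact: L1_meas L.
move=> [x y] /=; rewrite lee_fin sqdistE.
by have := dot_ge0 ((x : V) - 2 *: y); rewrite !dotE (dotC y x); lra.
Qed.

End Marginals.

Section Jensen.
Context (R : realType) (d : nat).
Local Notation V := 'rV[R]_d.
Local Notation X := (Rd R d).

Lemma convex_sub_affine (phi : V -> R) (p : V) (c : R) : convex_real phi ->
  convex_real (fun x => phi x - (dot p x + c)).
Proof. by move=> cp x y t t01; have := cp x y t t01; rewrite !dotE; lra. Qed.

Lemma convex_shift (phi : V -> R) (a : V) : convex_real phi ->
  convex_real (fun x => phi (a + x)).
Proof.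
move=> cp x y t t01; have := cp (a + x) (a + y) t t01; congr (phi _ <= _).
by apply/rowP => k; rewrite !mxE; ring.
Qed.

(* Subtracting an affine minorant reduces the convex order to nonnegative
   convex functions, for which all integrals make sense. *)
Lemma cx_le_nonneg (eta nu : probability X R) :
  finite_moment 1 eta -> finite_moment 1 nu ->
  (forall k, E eta (fun x : X => (x : V) ord0 k) = E nu (fun x : X => (x : V) ord0 k)) ->
  (forall psi : V -> R, convex_real psi -> (forall x, 0 <= psi x) ->
    (\int[eta]_x (psi x)%:E <= \int[nu]_x (psi x)%:E)%E) ->
  cx_le eta nu.
Proof.
move=> fe fn mean h phi cphi _ _.
have [p hp] := subgradient cphi 0.
pose l (x : X) := dot p x + phi 0.
have Le : L1 eta l by apply: L1D; [exact: fm1_dot|exact: L1_cst].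
have Ln : L1 nu l by apply: L1D; [exact: fm1_dot|exact: L1_cst].
have El : E eta l = E nu l.
  rewrite !E_D; try exact: fm1_dot; try exact: L1_cst.
  rewrite !E_cst; congr (_ + _); rewrite /dot !E_sum; last 2 first.
  - by move=> k; apply: L1Z; exact: fm1_coord.
  - by move=> k; apply: L1Z; exact: fm1_coord.
  by apply: eq_bigr => k _; rewrite !E_Z ?mean//; exact: fm1_coord.
have lphi x : l x <= phi x by have := hp x; rewrite subr0 addrC.
pose psi (x : V) := phi x - l x.
have cpsi : convex_real psi by exact: convex_sub_affine.
have psi0 x : 0 <= psi x by rewrite subr_ge0.
have mpsi := convex_meas cpsi.
have mphi := convex_meas cphi.
have [-> | ] := eqVneq (\int[nu]_x (phi x)%:E)%E +oo%E; first exact: leey.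
rewrite -ltey => fin.
have Lphi : L1 nu (phi : X -> R).
  by apply: (integrable_lower_bound _ Ln) => //; exact/measurable_EFinP.
have Lpsi : L1 nu (psi : X -> R) by exact: L1B.
have Lpsie : L1 eta (psi : X -> R).
  apply: L1_ge0 => //; apply: le_lt_trans (h _ cpsi psi0) _.
  by rewrite integral_E// ltry.
have pE x : phi x = psi x + l x by rewrite /psi subrK.
have Lphie : L1 eta (phi : X -> R).
  by rewrite (_ : phi = fun x => psi x + l x); [exact: L1D|exact/funext].
have EE (P : probability X R) : L1 P psi -> L1 P l -> E P phi = E P psi + E P l.
  by move=> h1 h2; rewrite -E_D//; exact: eq_E.
rewrite !integral_E// lee_fin !EE// El lerD2r -lee_fin -!integral_E//.
exact: h.
Qed.

(** Jensen's inequality for the measure h_i nu: a supporting affine function of [psi] at the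
    barycentre [z] is integrated against [h i]. *)
Lemma jensen_punity (I : finType) (nu : probability X R) (h : I -> X -> R) i
    (psi : V -> R) (m : R) (z : V) :
  finite_moment 1 nu -> punity h -> mass nu h i = m -> mom nu h i = m *: z ->
  convex_real psi ->
  ((m * psi z)%:E <= \int[nu]_y (h i y * psi y)%:E)%E.
Proof.
move=> fn ph hm hz cpsi.
have [p hp] := subgradient cpsi z.
pose al := dot p z - psi z.
have mh : measurable_fun setT (h i) by have [] := ph.
have h0 y : 0 <= h i y by have [] := ph.
have L := punity_aff_L1 fn (fun=> p) (fun=> al) i ph.
have -> : m * psi z = E nu (fun y => h i y * aff (fun=> p) (fun=> al) i y).
  by rewrite E_aff// hm hz dotZr /al; ring.
rewrite -integral_E//; apply: integral_mono.
- by apply/measurable_EFinP; exact: L1_meas L.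
- by apply/measurable_EFinP; apply: measurable_funM => //; exact: convex_meas.
move=> y; rewrite lee_fin ler_wpM2l// /aff /al; have := hp y; rewrite dotDr dotNr; lra.
Qed.

End Jensen.

(** * The two projections *)
Section Projections.
Context (R : realType) (d : nat).
Local Notation V := 'rV[R]_d.
Local Notation X := (Rd R d).
Variables (mu nu : probability X R) (I : finType) (s : X -> I) (h : I -> X -> R).
Variables (m : I -> R) (z : I -> V).
Hypotheses (mu2 : finite_moment 2 mu) (nu2 : finite_moment 2 nu).
Hypotheses (ms : forall i, measurable [set y | s y = i]).
Hypotheses (ph : punity h) (m0 : forall i, 0 < m i).
Hypotheses (mum : forall i, mass mu (fun i y => (s y == i)%:R) i = m i).
Hypotheses (num : forall i, mass nu h i = m i) (nuz : forall i, mom nu h i = m i *: z i).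

Let ps := punity_pick ms.
Let mu1 := fm2_fm1 mu2.
Let nu1 := fm2_fm1 nu2.
Let mh i : measurable_fun setT (h i). Proof. by have [] := ph. Qed.
Let h0 i y : 0 <= h i y. Proof. by have [] := ph. Qed.
Let h1 y : \sum_i h i y = 1. Proof. by have [] := ph. Qed.

Let zs (x : X) : X := z (s x).

Let mzs : measurable_fun setT zs.
Proof.
apply: Rd_meas_fun => k.
exact: (@meas_pick R _ _ _ _ ms (fun i _ => z i ord0 k) (fun i => measurable_cst _)).
Qed.

Let E_zs (f : I -> R) : L1 mu (fun x => f (s x)) /\
  E mu (fun x => f (s x)) = \sum_i m i * f i.
Proof.
have L i : L1 mu (fun x => (s x == i)%:R * f i).
  by exact: (punity_L1M i ps (L1_cst mu (f i))).
rewrite (_ : (fun x => f (s x)) = fun x => \sum_i (s x == i)%:R * f i); last first.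
  by apply/funext => x; exact: sum_pick.
split; first exact: L1_sum.
rewrite E_sum//; apply: eq_bigr => i _.
rewrite (@eq_E _ _ _ mu _ (fun x => f i * (s x == i)%:R)); last by move=> x; rewrite mulrC.
rewrite E_Z; last exact: (punity_L1 mu i ps).
by rewrite mulrC; congr (_ * _); exact: mum.
Qed.

Let mean_z k : \sum_i m i * z i ord0 k = E nu (fun y : X => (y : V) ord0 k).
Proof.
have hk := fm1_coord k nu1.
rewrite (_ : E nu _ = E nu (fun y : X => \sum_i h i y * (y : V) ord0 k)).
  rewrite E_sum; last by move=> i; exact: punity_L1M.
  apply: eq_bigr => i _; have := congr1 (fun v : V => v ord0 k) (nuz i).
  by rewrite /= !mxE.
by apply: eq_E => y; rewrite -mulr_suml h1 mul1r.
Qed.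

Let msq : measurable_fun setT (fun x : X => sqdist (x : V) (zs x)).
Proof. by apply: meas_sqdist => //; exact: measurable_id. Qed.

Let eta : probability X R := push mu mzs.

Let fm2_eta : finite_moment 2 eta.
Proof.
rewrite /finite_moment; under eq_integral do rewrite enorm2.
rewrite integral_push; last by apply/measurable_EFinP; exact: meas_dot2.
have [L _] := E_zs (fun i => dot (z i) (z i)).
by rewrite (_ : (fun x => _) = fun x => (dot (z (s x)) (z (s x)))%:E)// integral_E// ltry.
Qed.

(** The integral of [psi] under [nu] splits along the partition into integrals of [h i * psi], and
    Jensen bounds each of them below by [m i * psi (z i)]. *)
Let eta_le : cx_le eta nu.
Proof.
apply: cx_le_nonneg => //; first exact: fm2_fm1.
  move=> k; rewrite -mean_z; have [L <-] := E_zs (fun i => z i ord0 k).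
  rewrite /E /Rintegral integral_push//.
  by apply/measurable_EFinP; exact: Rd_meas_coord.
move=> psi cpsi psi0.
have mpsi : measurable_fun setT (psi : X -> R) by exact: convex_meas.
rewrite integral_push; last exact/measurable_EFinP.
have [L LE] := E_zs (fun i => psi (z i)).
rewrite [leLHS](integral_E L) LE.
rewrite (_ : (\int[nu]_y (psi y)%:E)%E = (\int[nu]_y \sum_i (h i y * psi y)%:E)%E); last first.
  by apply: eq_integral => y _; rewrite sumEFin -mulr_suml h1 mul1r.
rewrite ge0_integral_sum//; last 2 first.
- by move=> i; apply/measurable_EFinP; exact: measurable_funM.
- by move=> i y _; rewrite lee_fin mulr_ge0.
rewrite -sumEFin; apply: lee_sum => i _; exact: jensen_punity.
Qed.

Let mgraph : measurable_fun setT (fun x : X => (x, zs x)).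
Proof. by apply: measurable_fun_pair => //; exact: measurable_id. Qed.

Lemma T2_to_set_le :
  (T2_to_set mu (Pcx_le 2 nu) <= \int[mu]_x (sqdist (x : V) (z (s x)))%:E)%E.
Proof.
apply: (@le_trans _ _ (T2 mu eta)).
  by apply: ereal_inf_lbound; exists eta.
apply: ereal_inf_lbound; exists (push mu mgraph).
  split => A mA; rewrite (pushE mu mgraph).
    by congr (mu _); apply/seteqP; split => [x []|x].
  by rewrite (pushE mu mzs); congr (mu _); apply/seteqP; split => [x []|x].
rewrite integral_push//.
by apply/measurable_EFinP; exact: meas_sqdist_prod.
Qed.

(* Given x in the cell i, the second point has law h_i nu / m_i. *)
Let H (w : X * X) : R := h (s w.1) w.2 / m (s w.1).

Let mfst i : measurable [set w : X * X | s w.1 = i].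
Proof.
by have := @measurable_fst _ _ X X measurableT _ (ms i); rewrite setTI.
Qed.

Let mH : measurable_fun setT H.
Proof.
apply: (@meas_pick R _ _ _ (fun w : X * X => s w.1) mfst (fun i w => h i w.2 / m i)) => i.
apply: measurable_funM; last exact: measurable_cst.
exact: (measurableT_comp (mh i) measurable_snd).
Qed.

Let H0 w : 0 <= H w.
Proof. by rewrite divr_ge0// ltW. Qed.

(** Averaging over the cells cancels the masses and leaves sum_i h_i(y) = 1. This yields the second
    marginal of [K], and [int_H_snd] the first. *)
Let int_H_fst y : (\int[mu]_x (H (x, y))%:E = 1)%E.
Proof.
rewrite /H /=; have [L LE] := E_zs (fun i => h i y / m i).
rewrite (integral_E L) LE -(h1 y); congr (_%:E); apply: eq_bigr => i _.
by rewrite mulrC divfK// gt_eqF.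
Qed.

Let int_H_snd x : (\int[nu]_y (H (x, y))%:E = 1)%E.
Proof.
rewrite /H /=; have L := punity_L1 nu (s x) ph.
rewrite integral_E; last first.
  by rewrite (_ : (fun y => _) = fun y => (m (s x))^-1 * h (s x) y);
    [exact: L1Z|apply/funext => y; rewrite mulrC].
under eq_E do rewrite mulrC.
by rewrite E_Z// -/(mass nu h (s x)) num mulVf// gt_eqF.
Qed.

Let H1 : (\int[mu \x nu]_w (H w)%:E = 1)%E.
Proof.
rewrite fubini_tonelli2; last 2 first.
- exact/measurable_EFinP.
- by move=> w; rewrite lee_fin.
rewrite /fubini_G; under eq_integral do rewrite int_H_fst.
by rewrite integral_cst// mul1e [LHS]probability_setT.
Qed.

Let K : probability (X * X)%type R := dens_prob mH H0 H1.

Let integral_K (g : X * X -> \bar R) : measurable_fun setT g -> (forall w, 0 <= g w)%E ->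
  (\int[K]_w g w = \int[mu \x nu]_w (g w * (H w)%:E))%E.
Proof. exact: dens_integral. Qed.

Let mgH (g : X * X -> \bar R) : measurable_fun setT g ->
  measurable_fun setT (fun w => g w * (H w)%:E)%E.
Proof. by move=> mg; apply: emeasurable_funM => //; exact/measurable_EFinP. Qed.

Let gH0 (g : X * X -> \bar R) : (forall w, 0 <= g w)%E -> forall w, (0 <= g w * (H w)%:E)%E.
Proof. by move=> g0 w; rewrite mule_ge0// lee_fin. Qed.

Let K_coupling : coupling mu nu K.
Proof.
split => A mA.
  have mf : measurable_fun [set: X * X] (fun w : X * X => (\1_A w.1)%:E : \bar R).
    by apply/measurable_EFinP; apply: (measurableT_comp _ measurable_fst); exact: measurable_indic.
  have f0 (w : X * X) : (0 <= (\1_A w.1)%:E :> \bar R)%E by rewrite lee_fin.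
  rewrite (_ : K _ = \int[K]_w (\1_A w.1)%:E)%E; last first.
    rewrite -[in LHS](setIT (A `*` setT)) -(integral_indic K measurableT); last exact: measurableX.
    by apply: eq_integral => w _; rewrite !indicE; congr (nat_of_bool _)%:R%:E;
      apply/idP/idP => /set_mem hw; apply/mem_set; [case: hw|split].
  rewrite integral_K// fubini_tonelli1; [|exact: mgH|exact: gH0].
  rewrite /fubini_F -[in RHS](setIT A) -(integral_indic mu measurableT mA).
  apply: eq_integral => x _ /=.
  rewrite ge0_integralZl//; last 2 first.
  - by apply/measurable_EFinP; exact: (measurable_fun_pair2 x mH).
  - by move=> y _; rewrite lee_fin.
  by rewrite int_H_snd mule1.
have mf : measurable_fun [set: X * X] (fun w : X * X => (\1_A w.2)%:E : \bar R).
  by apply/measurable_EFinP; apply: (measurableT_comp _ measurable_snd); exact: measurable_indic.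
have f0 (w : X * X) : (0 <= (\1_A w.2)%:E :> \bar R)%E by rewrite lee_fin.
rewrite (_ : K _ = \int[K]_w (\1_A w.2)%:E)%E; last first.
  rewrite -[in LHS](setIT (setT `*` A)) -(integral_indic K measurableT); last exact: measurableX.
  by apply: eq_integral => w _; rewrite !indicE; congr (nat_of_bool _)%:R%:E;
    apply/idP/idP => /set_mem hw; apply/mem_set; [case: hw|split].
rewrite integral_K// fubini_tonelli2; [|exact: mgH|exact: gH0].
rewrite /fubini_G -[in RHS](setIT A) -(integral_indic nu measurableT mA).
apply: eq_integral => y _ /=.
rewrite ge0_integralZl//; last 2 first.
- by apply/measurable_EFinP; exact: (measurable_fun_pair1 y mH).
- by move=> x _; rewrite lee_fin.
by rewrite int_H_fst mule1.
Qed.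

Let T (w : X * X) : X := (w.1 : V) + ((w.2 : V) - z (s w.1)).

Let mT : measurable_fun setT T.
Proof.
apply: Rd_meas_fun => k.
rewrite (_ : (fun w => _) = fun w : X * X =>
  (w.1 : V) ord0 k + ((w.2 : V) ord0 k - (zs w.1 : V) ord0 k)); last first.
  by apply/funext => w; rewrite /T !mxE.
have mk := @Rd_meas_coord R d k.
apply: measurable_funD; first exact: (measurableT_comp mk measurable_fst).
apply: measurable_funB; first exact: (measurableT_comp mk measurable_snd).
exact: (measurableT_comp mk (measurableT_comp mzs measurable_fst)).
Qed.

Let mTsnd : measurable_fun setT (fun w => (T w, w.2)).
Proof. by apply: measurable_fun_pair => //; exact: measurable_snd. Qed.

Let xi : probability X R := push K mT.
Let Kxi : probability (X * X)%type R := push K mTsnd.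

Let Kxi_coupling : coupling xi nu Kxi.
Proof.
split => A mA; rewrite (pushE K mTsnd).
  by rewrite (pushE K mT); congr (K _); apply/seteqP; split => [x []|x].
have [_ <-//] := K_coupling; congr (K _).
Qed.

(** The displacement [T w - w.2] equals [w.1 - z (s w.1)], so the cost sees only the first point,
    whose law under [K] is [mu]. *)
Let Kxi_cost : (\int[Kxi]_w (sqdist (w.1 : V) (w.2 : V))%:E =
  \int[mu]_x (sqdist (x : V) (z (s x)))%:E)%E.
Proof.
rewrite integral_push; last by apply/measurable_EFinP; exact: meas_sqdist_prod.
rewrite -(coupling_fst K_coupling (g := fun x : X => (sqdist (x : V) (z (s x)))%:E));
  last exact/measurable_EFinP.
apply: eq_integral => w _ /=; rewrite !sqdist_dot; congr (_%:E).
by rewrite /T (_ : (w.1 : V) + _ - _ = (w.1 : V) - z (s w.1))//; apply/rowP => k; rewrite !mxE; ring.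
Qed.

Let cost_fin : (\int[mu]_x (sqdist (x : V) (z (s x)))%:E < +oo)%E.
Proof.
have [L _] := E_zs (fun i => dot (z i) (z i)).
have L' : L1 mu (fun x : X => 2 * dot x x + 2 * dot (z (s x)) (z (s x))).
  by apply: L1D; apply: L1Z => //; exact: fm2P.
have := ltry (E mu (fun x : X => 2 * dot x x + 2 * dot (z (s x)) (z (s x)))).
rewrite -integral_E//; apply: le_lt_trans; apply: integral_mono.
- exact/measurable_EFinP.
- by apply/measurable_EFinP; exact: L1_meas L'.
move=> x; rewrite lee_fin sqdistE.
by have := dot_ge0 ((x : V) + z (s x)); rewrite !dotE (dotC (z (s x)) x); lra.
Qed.

Let fm2_xi : finite_moment 2 xi.
Proof. by apply: (coupling_fm2 Kxi_coupling) => //; rewrite Kxi_cost. Qed.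

(** Given x, the point [T] has conditional mean x, because h_i nu / m_i has barycentre [z i]. Jensen
    for a translate of [psi] bounds [psi x] by the conditional integral. *)
Let xi_ge : cx_le mu xi.
Proof.
apply: cx_le_nonneg => //; first exact: fm2_fm1.
  move=> k.
  have [L2 L2E] := coupling_E_fst K_coupling (fm1_coord k mu1).
  have [L3 L3E] := coupling_E_snd K_coupling (fm1_coord k nu1).
  have [L4 L4E] := E_zs (fun i => z i ord0 k).
  have [L5 L5E] := coupling_E_fst K_coupling L4.
  have -> : E xi (fun x : X => (x : V) ord0 k) = E K (fun w : X * X =>
      (w.1 : V) ord0 k + ((w.2 : V) ord0 k - z (s w.1) ord0 k)).
    rewrite /E /Rintegral integral_push; last by apply/measurable_EFinP; exact: Rd_meas_coord.
    by congr fine; apply: eq_integral => w _; rewrite /T !mxE.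
  by rewrite E_D ?E_B// ?L2E ?L3E ?L5E ?L4E ?mean_z ?subrr ?addr0//; exact: L1B.
move=> psi cpsi psi0.
have mpsi : measurable_fun setT (psi : X -> R) by exact: convex_meas.
rewrite [leRHS](integral_push K mT); last exact/measurable_EFinP.
have mg : measurable_fun setT (fun w => (psi (T w))%:E).
  by apply/measurable_EFinP; exact: (measurableT_comp mpsi mT).
have g0 w : (0 <= (psi (T w))%:E)%E by rewrite lee_fin.
rewrite [leRHS](integral_K mg g0) fubini_tonelli1; [|exact: mgH|exact: gH0].
apply: integral_mono; first exact/measurable_EFinP.
  by apply: measurable_fun_fubini_tonelli_F; [exact: mgH|exact: gH0].
move=> x; rewrite /fubini_F /T /H /=.
have := jensen_punity nu1 ph (num (s x)) (nuz (s x)) (convex_shift (x - z (s x)) cpsi).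
rewrite subrK => hJ.
under eq_integral => y _.
  rewrite -EFinM [X in X%:E](_ : _ = (m (s x))^-1 * (h (s x) y * psi (x - z (s x) + y))); last first.
    by rewrite addrA (addrAC x) mulrC mulrAC mulrC.
  rewrite EFinM.
over.
rewrite ge0_integralZl_EFin//; last 3 first.
- by move=> y _; rewrite lee_fin mulr_ge0.
- by apply/measurable_EFinP; apply: measurable_funM => //; exact: (convex_meas (convex_shift _ cpsi)).
- by rewrite invr_ge0 ltW.
rewrite -(mulKf (lt0r_neq0 (m0 (s x))) (psi x)) EFinM; apply: lee_pmul => //.
- by rewrite lee_fin invr_ge0 ltW.
- by rewrite lee_fin mulr_ge0// ltW.
Qed.

Lemma T2_from_set_le :
  (T2_from_set (Pcx_ge 2 mu) nu <= \int[mu]_x (sqdist (x : V) (z (s x)))%:E)%E.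
Proof.
apply: (@le_trans _ _ (T2 xi nu)).
  by apply: ereal_inf_lbound; exists xi.
by apply: ereal_inf_lbound; exists Kxi.
Qed.

End Projections.

(** * Strong duality *)
Section Transforms.
Context (R : realType) (d : nat).
Local Notation V := 'rV[R]_d.
Local Notation X := (Rd R d).

Lemma continuous_sqdist (y : V) : continuous (fun x : V => sqdist x y).
Proof.
have -> : (fun x : V => sqdist x y) = fun x => dot x x - (2 * dot y x - dot y y).
  by apply/funext => x; rewrite sqdistE (dotC y); ring.
have c1 : continuous (fun x : V => dot x x).
  rewrite /dot; apply: continuous_big => [|k _ z]; first exact: add_continuous.
  by apply: (@cvgM _ _ (nbhs z) _ (fun y : V => y ord0 k) (fun y : V => y ord0 k)); exact: coord_continuous.
have c2 : continuous (fun x : V => dot y x) by exact: continuous_dot.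
move=> x; apply: (@continuousB _ _ _ (fun x : V => dot x x) (fun x : V => 2 * dot y x - dot y y)).
  exact: c1.
apply: (@continuousB _ _ _ (fun x : V => 2 * dot y x) (cst (dot y y))); last exact: cst_continuous.
by apply: (@continuousM _ _ (cst 2) (fun x : V => dot y x)); [exact: cst_continuous|exact: c2].
Qed.

Lemma open_lt_continuous (f : V -> R) a : continuous f -> open [set x | f x < a].
Proof.
move=> cf; have := @open_comp _ _ f [set r | r < a].
by move/(_ (fun x _ => cf x) (@open_lt _ a)).
Qed.

(** An infimum of functions that are continuous or constantly infinite in x has open strict sublevel
    sets. *)
Lemma Q2_meas (phi : V -> \bar R) : measurable_fun [set: X] (Q2 phi : X -> \bar R).
Proof.
apply: Rd_usc_meas => a.
rewrite (_ : [set x | _] = \bigcup_y [set x | (phi y + (sqdist x y)%:E < a%:E)%E]).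
  apply: bigcup_open => y _; case: (phi y) => [r| |].
  - rewrite (_ : [set x | _] = [set x | sqdist x y < a - r]).
      by apply: open_lt_continuous; exact: continuous_sqdist.
    by apply/seteqP; split => x /=; rewrite -EFinD lte_fin; lra.
  - rewrite (_ : [set x | _] = set0); first exact: open0.
    by apply/seteqP; split => x.
  - rewrite (_ : [set x | _] = setT); first exact: openT.
    by apply/seteqP; split => x //= _; rewrite ltNyr.
apply/seteqP; split => [x /= /ereal_inf_lt[_ [y _ <-] h]|x [y _ /= h]].
  by exists y.
by apply: le_lt_trans h; apply: ereal_inf_lbound; exists y.
Qed.

Lemma Q2bar_meas (phi : V -> \bar R) : measurable_fun [set: X] (Q2bar phi : X -> \bar R).
Proof.
apply: Rd_lsc_meas => a.
rewrite (_ : [set x | _] = \bigcup_y [set x | (a%:E < phi y - (sqdist y x)%:E)%E]).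
  apply: bigcup_open => y _.
  have sC (x : V) : sqdist y x = sqdist x y by rewrite !sqdistE (dotC y); ring.
  case: (phi y) => [r| |].
  - rewrite (_ : [set x | _] = [set x | sqdist x y < r - a]).
      by apply: open_lt_continuous; exact: continuous_sqdist.
    by apply/seteqP; split => x /=; rewrite -EFinB lte_fin sC; lra.
  - rewrite (_ : [set x | _] = setT); first exact: openT.
    by apply/seteqP; split => x //= _; rewrite ltry.
  - rewrite (_ : [set x | _] = set0); first exact: open0.
    by apply/seteqP; split => x.
apply/seteqP; split => [x /= /ereal_sup_gt[_ [y _ <-] h]|x [y _ /= h]].
  by exists y.
by apply: lt_le_trans h _; apply: ereal_sup_ubound; exists y.
Qed.

Lemma Q2_le (phi : V -> \bar R) x y : (Q2 phi x <= phi y + (sqdist x y)%:E)%E.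
Proof. by apply: ereal_inf_lbound; exists y. Qed.

Lemma Q2bar_ge (phi : V -> \bar R) x y : (phi x - (sqdist x y)%:E <= Q2bar phi y)%E.
Proof. by apply: ereal_sup_ubound; exists x. Qed.

End Transforms.

(** * Max-affine functions as competitors in the dual problems *)

Section MaxAffineDual.
Context (R : realType) (d : nat) (I : finType) (i0 : I).
Local Notation V := 'rV[R]_d.
Local Notation X := (Rd R d).
Variables (p : I -> V).
Implicit Types (alpha : I -> R).

Let aff_convex alpha i (x y : V) t :
  aff p alpha i (t *: x + (1 - t) *: y) = t * aff p alpha i x + (1 - t) * aff p alpha i y.
Proof. by rewrite /aff !dotE; ring. Qed.

Lemma amax_convex alpha : convex_real (amax i0 p alpha).
Proof.
move=> x y t /andP[t0 t1]; have [i ->] := amax_ex i0 p alpha (t *: x + (1 - t) *: y).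
by rewrite aff_convex lerD// ler_wpM2l ?subr_ge0// amax_ge.
Qed.

Let C := \sum_i \sum_(k < d) `|p i ord0 k|.

Let p_le i x : `|dot (p i) x| <= C * enorm x.
Proof.
apply: (le_trans (dot_le_enorm _ _)); rewrite ler_wpM2r ?enorm_ge0//.
by rewrite /C (bigD1 i)//= lerDl; do 2 apply: sumr_ge0 => ? _.
Qed.

Let C0 : 0 <= C. Proof. by do 2 apply: sumr_ge0 => ? _. Qed.

Lemma amax_lip alpha x y : amax i0 p alpha x - amax i0 p alpha y <= C * d%:R * `|x - y|.
Proof.
have [i ->] := amax_ex i0 p alpha x; have := amax_ge i0 p alpha i y.
have -> : aff p alpha i x = aff p alpha i y + dot (p i) (x - y) by rewrite /aff !dotE; ring.
have := le_trans (ler_norm _) (p_le i (x - y)).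
have := ler_wpM2l C0 (enorm_le_mxnorm (x - y)); rewrite mulrA; lra.
Qed.

Lemma amax_continuous alpha : continuous (amax i0 p alpha).
Proof.
move=> x; apply/(@cvgrPdist_le _ _ _ (nbhs x)) => e e0.
have L0 : 0 <= C * d%:R by rewrite mulr_ge0.
have L1 : 0 < C * d%:R + 1 by lra.
apply/nbhs_ballP; exists (e / (C * d%:R + 1)) => [|y] /=; first by rewrite divr_gt0.
rewrite -ball_normE /= => /ltW h.
have h1 : C * d%:R * `|x - y| <= e.
  move: h; rewrite ler_pdivlMr//; have := normr_ge0 (x - y); lra.
have h2 := amax_lip alpha x y; have := amax_lip alpha y x; rewrite distrC => h3.
by rewrite ler_norml; apply/andP; split; lra.
Qed.

Lemma amax_growth alpha : growth_bound 1 (amax i0 p alpha).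
Proof.
exists (C + \sum_i `|alpha i|) => x; rewrite expr1.
have [i ->] := amax_ex i0 p alpha x; rewrite /aff (le_trans (ler_normB _ _))//.
have h1 := p_le i x.
have h2 : `|alpha i| <= \sum_i `|alpha i| by rewrite (bigD1 i)//= lerDl sumr_ge0.
have h3 := enorm_ge0 x.
have := mulr_ge0 (le_trans (normr_ge0 _) h2) h3; have := C0; lra.
Qed.

Lemma amax_A_cx alpha : A_cx (fun y => (amax i0 p alpha y)%:E).
Proof.
split => //; first by exists 0.
- apply/lower_semicontinuousP => a.
  have := @convex_lsc _ _ _ (amax_convex alpha) a.
  by congr open; apply/seteqP; split => x /=; rewrite lte_fin.
- by move=> x y t t01; rewrite -!EFinM -EFinD lee_fin; exact: amax_convex.
Qed.

Lemma amax_C_b1 alpha : C_bk 1 (fun y => (amax i0 p alpha y)%:E).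
Proof. by split => //=; [exact: amax_continuous|exact: amax_growth]. Qed.

Lemma amax_L1 alpha (P : probability X R) : finite_moment 1 P -> L1 P (amax i0 p alpha).
Proof.
move=> f1; have [c hc] := amax_growth alpha.
apply: (@L1_le _ _ _ _ _ (fun x : X => c * (1 + enorm x))).
- exact: convex_meas (amax_convex alpha).
- by move=> x; rewrite -[enorm x]expr1; exact: hc.
- by apply: L1Z; apply: L1D; [exact: L1_cst|exact: fm1P].
Qed.

(** The [Q2] transform of p.y - a is p.x - a - |p|^2/4; the shift is applied to each piece. *)
Definition lift_alpha alpha i : R := alpha i + dot (p i) (p i) / 4.

(* Completing the square: |x - y|^2 - p.(x - y) + |p|^2/4 = |x - y - p/2|^2. *)
Lemma amax_lift alpha x y :
  amax i0 p (lift_alpha alpha) x <= amax i0 p alpha y + sqdist x y.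
Proof.
have [i ->] := amax_ex i0 p (lift_alpha alpha) x; have := amax_ge i0 p alpha i y.
have := dot_ge0 (x - y - 2^-1 *: p i); rewrite /aff /lift_alpha sqdistE !dotE.
rewrite (dotC y x) (dotC x (p i)) (dotC y (p i)); lra.
Qed.

Variables (mu nu : probability X R).
Hypotheses (mu1 : finite_moment 1 mu) (nu1 : finite_moment 1 nu).

Lemma dual_i_ge alpha :
  ((E mu (amax i0 p (lift_alpha alpha)) - E nu (amax i0 p alpha))%:E <=
   dual_i mu nu [set phi | A_cx phi /\ C_bk 1 phi])%E.
Proof.
pose phi y := (amax i0 p alpha y)%:E.
apply: (@le_trans _ _ (\int[mu]_x Q2 phi x - \int[nu]_x phi x)%E); last first.
  by apply: ereal_sup_ubound; exists phi => //; split; [exact: amax_A_cx|exact: amax_C_b1].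
rewrite EFinB -!integral_E; [|exact: amax_L1..].
rewrite leeB//; apply: integral_mono.
- by apply/measurable_EFinP; exact: convex_meas (amax_convex _).
- exact: Q2_meas.
by move=> x; apply: le_ereal_inf_tmp => _ [y _ <-]; rewrite -EFinD lee_fin; exact: amax_lift.
Qed.

(** Here the lifted function is the test function, and [amax_lift] bounds its [Q2bar] transform by
    [amax i0 p alpha]. The same number thus bounds both dual problems from below. *)
Lemma dual_ii_ge alpha :
  ((E mu (amax i0 p (lift_alpha alpha)) - E nu (amax i0 p alpha))%:E <=
   dual_ii mu nu [set phi | A_cx phi /\ C_bk 1 phi])%E.
Proof.
pose phi y := (amax i0 p (lift_alpha alpha) y)%:E.
apply: (@le_trans _ _ (\int[mu]_x phi x - \int[nu]_x Q2bar phi x)%E); last first.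
  by apply: ereal_sup_ubound; exists phi => //; split; [exact: amax_A_cx|exact: amax_C_b1].
rewrite EFinB -!integral_E; [|exact: amax_L1..].
rewrite leeB//; apply: integral_mono.
- exact: Q2bar_meas.
- by apply/measurable_EFinP; exact: convex_meas (amax_convex _).
move=> y; apply: ge_ereal_sup => _ [x _ <-]; rewrite -EFinB lee_fin lerBlDr.
exact: amax_lift.
Qed.

End MaxAffineDual.

Section StrongDuality.
Context (R : realType) (d : nat).
Local Notation V := 'rV[R]_d.
Local Notation X := (Rd R d).
Variables (mu nu : probability X R).
Hypotheses (mu2 : finite_moment 2 mu) (nu2 : finite_moment 2 nu).

(** One partition and one family of slopes serve both problems, because the two projections have the
    same cost. *)
Lemma near_duality eps : 0 < eps ->
  exists (I : finType) (i0 : I) (p : I -> V) (alpha : I -> R) (J :=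
    E mu (amax i0 p (lift_alpha p alpha)) - E nu (amax i0 p alpha)),
  (T2_to_set mu (Pcx_le 2 nu) <= (J + eps)%:E)%E /\
  (T2_from_set (Pcx_ge 2 mu) nu <= (J + eps)%:E)%E.
Proof.
move=> e0; have e2 : 0 < eps / 2 by rewrite divr_gt0.
have mu1 := fm2_fm1 mu2; have nu1 := fm2_fm1 nu2.
have [I [i0 [s [c [ms m0 hq]]]]] := quantization mu2 e2.
pose q (i : I) (y : X) : R := (s y == i)%:R.
have pq : punity q := punity_pick ms.
pose m i := mass mu q i.
have m1 : \sum_i m i = 1 by exact: sum_mass.
pose x i := (m i)^-1 *: mom mu q i.
have xm i : mom mu q i = m i *: x i.
  by rewrite /x scalerA divff ?scale1r// gt_eqF// m0.
have [h [z [p [alpha [ph hm hz hle]]]]] :=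
  semidiscrete_duality i0 x nu1 m0 m1 e2.
exists I, i0, p, alpha => J.
have Eq (p' : I -> V) (al' : I -> R) : E mu (fun y => \sum_i q i y * aff p' al' i y) =
    \sum_i m i * aff p' al' i (x i).
  rewrite E_punity_aff//; apply: eq_bigr => i _.
  by rewrite xm -/(m i) /aff dotZr; ring.
have L (e : I -> V) : L1 mu (fun y : X => sqdist (y : V) (e (s y))).
  rewrite (_ : (fun y => _) = fun y : X => dot y y + \sum_i q i y * aff (fun i => - 2 *: e i) (fun i => - dot (e i) (e i)) i y).
    by apply: L1D; [exact: fm2P|apply: L1_sum => i; exact: punity_aff_L1].
  apply/funext => y; rewrite -(@sum_pick R _ _ s (fun i => aff _ _ i y)) /aff.
  by rewrite sqdistE !dotE (dotC y); ring.
have cost : E mu (fun y : X => sqdist (y : V) (z (s y))) <= J + eps.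
  (* In cell i the difference |y - z_i|^2 - |y - c_i|^2 is affine, so its integral is [m i] times
     its value at the barycentre [x i], which is at most |x_i - z_i|^2. *)
  pose p' i := 2 *: (c i - z i).
  pose al' i := dot (c i) (c i) - dot (z i) (z i).
  have -> : E mu (fun y : X => sqdist (y : V) (z (s y))) =
      E mu (fun y : X => sqdist (y : V) (c (s y))) + \sum_i m i * aff p' al' i (x i).
    rewrite -Eq -E_D//; last by apply: L1_sum => i; exact: punity_aff_L1.
    apply: eq_E => y; rewrite -(@sum_pick R _ _ s (fun i => aff p' al' i y)).
    by rewrite /aff /p' /al' !sqdistE !dotE !(dotC y); ring.
  have h1 : \sum_i m i * aff p' al' i (x i) <= \sum_i m i * sqdist (x i) (z i).
    apply: ler_sum => i _; rewrite ler_pM2l ?m0//.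
    move: (x i) => u; have := sqdist_ge0 u (c i).
    by rewrite /aff /p' /al' !sqdistE !dotE !(dotC u); lra.
  (* On cell i the maximum is at least its i-th piece, whose integral is [m i] times its value at
     [x i]. *)
  have h2 : \sum_i m i * (aff p alpha i (x i) - dot (p i) (p i) / 4) <=
      E mu (amax i0 p (lift_alpha p alpha)).
    rewrite (eq_bigr (fun i => m i * aff p (lift_alpha p alpha) i (x i))); last first.
      by move=> i _; rewrite /aff /lift_alpha; ring.
    rewrite -Eq; apply: E_le; [|exact: amax_L1|].
      by apply: L1_sum => i; exact: punity_aff_L1.
    move=> y; rewrite -(@sum_pick R _ _ s (fun i => aff _ _ i y)); exact: amax_ge.
  move: hq hle; rewrite /J -/(m _); lra.
have hi := T2_to_set_le nu2 ms ph (fun=> erefl) hm hz.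
have hii := T2_from_set_le mu2 nu2 ms ph m0 (fun=> erefl) hm hz.
have cE : (\int[mu]_y (sqdist (y : V) (z (s y)))%:E <= (J + eps)%:E)%E.
  by rewrite (integral_E (L z)) lee_fin.
by split; [exact: le_trans hi cE|exact: le_trans hii cE].
Qed.

Lemma strong_duality_i :
  (T2_to_set mu (Pcx_le 2 nu) <= dual_i mu nu [set phi | A_cx phi /\ C_bk 1 phi])%E.
Proof.
apply/lee_addgt0Pr => e e0; have [I [i0 [p [alpha [h _]]]]] := near_duality e0.
apply: le_trans h _; rewrite EFinD leeD2r//; apply: dual_i_ge; exact: fm2_fm1.
Qed.

Lemma strong_duality_ii :
  (T2_from_set (Pcx_ge 2 mu) nu <= dual_ii mu nu [set phi | A_cx phi /\ C_bk 1 phi])%E.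
Proof.
apply/lee_addgt0Pr => e e0; have [I [i0 [p [alpha [_ h]]]]] := near_duality e0.
apply: le_trans h _; rewrite EFinD leeD2r//; apply: dual_ii_ge; exact: fm2_fm1.
Qed.

End StrongDuality.

(** * Lipschitz regularization of convex functions *)
Section LipschitzRegularization.
Context (R : realType) (d : nat).
Local Notation V := 'rV[R]_d.
Local Notation X := (Rd R d).
Variable phi : V -> \bar R.
Hypothesis Aphi : A_cx phi.

(* Lower semicontinuity bounds phi from below on a ball around a point x0 of
   its domain; convexity along rays from x0 propagates a linear bound. *)
Lemma A_cx_minorant : exists (x0 : V) (r L : R), [/\ phi x0 = r%:E, 0 <= L &
  forall x, ((r - 1 - L * `|x - x0|)%:E <= phi x)%E].
Proof.
have [nNy [x0 x0fin] lsc cvx] := Aphi.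
have [r rE] : exists r, phi x0 = r%:E by exists (fine (phi x0)); rewrite fineK.
have [W nW hW] : exists2 W, nbhs x0 W & forall y, W y -> ((r - 1)%:E < phi y)%E.
  by apply: lsc; rewrite rE lte_fin; lra.
have /nbhs_ballP[rho /= rho0 hrho] := nW.
pose delta := rho / 2.
have delta0 : 0 < delta by rewrite divr_gt0.
exists x0, r, delta^-1; split => //; first by rewrite invr_ge0 ltW.
move=> x.
have near y : `|y - x0| <= delta -> ((r - 1)%:E < phi y)%E.
  move=> hy; apply/hW/hrho; rewrite -ball_normE /= distrC.
  by apply: le_lt_trans hy _; rewrite /delta ltr_pdivrMr//; lra.
have [hx|hx] := leP `|x - x0| delta.
  apply: le_trans (ltW (near x hx)); rewrite lee_fin.
  have : 0 <= delta^-1 * `|x - x0| by rewrite mulr_ge0 ?invr_ge0 ?(ltW delta0).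
  lra.
have nx : 0 < `|x - x0| by exact: lt_trans hx.
(* The point at parameter [s] on the segment from [x0] to [x] is at distance [delta] from [x0],
   where the local bound holds. *)
pose s := delta / `|x - x0|.
have s0 : 0 < s by rewrite divr_gt0.
have s1 : s <= 1 by rewrite ler_pdivrMr// mul1r ltW.
have s01 : 0 <= s <= 1 by rewrite (ltW s0).
have := near (s *: x + (1 - s) *: x0).
have -> : s *: x + (1 - s) *: x0 - x0 = s *: (x - x0).
  by apply/rowP => k; rewrite !mxE; ring.
rewrite normrZ gtr0_norm// divfK ?gt_eqF// lexx => /(_ isT) h.
have := lt_le_trans h (cvx x x0 s s01).
have := nNy x; case: (phi x) => [q| |]// _.
  rewrite rE -!EFinM -EFinD lte_fin lee_fin => h2.
  have h3 : s * r - 1 < s * q by lra.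
  have h4 : r - s^-1 < q.
    by rewrite -(ltr_pM2l s0) mulrBr mulfV// gt_eqF.
  have -> : delta^-1 * `|x - x0| = s^-1 by rewrite /s; field; rewrite !gt_eqF.
  lra.
by rewrite leey.
Qed.

Lemma mxnorm_L1 (P : probability X R) (x0 : V) : finite_moment 1 P ->
  L1 P (fun x : X => `|(x : V) - x0|).
Proof.
move=> f1; apply: (@L1_le _ _ _ _ _ (fun x : X => enorm x + `|x0|)).
- apply: (@convex_meas _ _ (fun x : V => `|x - x0|)) => x y t /andP[t0 t1].
  have -> : t *: x + (1 - t) *: y - x0 = t *: (x - x0) + (1 - t) *: (y - x0).
    by apply/rowP => k; rewrite !mxE; ring.
  by rewrite (le_trans (ler_normD _ _))// !normrZ !ger0_norm// subr_ge0.
- move=> x; rewrite normr_id (le_trans (ler_normB _ _))// lerD2r.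
  exact: mxnorm_le_enorm.
- by apply: L1D; [exact: fm1P|exact: L1_cst].
Qed.

Lemma A_cx_meas : measurable_fun [set: X] (phi : X -> \bar R).
Proof.
have [_ _ lsc _] := Aphi; apply: Rd_lsc_meas => a.
by have /lower_semicontinuousP := lsc; apply.
Qed.

Variables (x0 : V) (r L : R).
Hypotheses (rE : phi x0 = r%:E) (L0 : 0 <= L).
Hypothesis lo_le : forall x, ((r - 1 - L * `|x - x0|)%:E <= phi x)%E.

Let lo (x : V) : R := r - 1 - L * `|x - x0|.
(** An integer slope above [L]; from it on, the regularizations stay above [lo]. *)
Let N : nat := (Num.truncn L).+1.
Let LN : L <= N%:R. Proof. by rewrite ltW// truncnS_gt. Qed.

(** The Pasch-Hausdorff envelope of [phi]: its infimal convolution with a multiple of the sup norm.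
    The offset [N] keeps it finite for every [n]. *)
Definition lipreg_e (n : nat) (x : V) : \bar R :=
  ereal_inf [set phi y + ((N + n)%:R * `|x - y|)%:E | y in [set: V]]%E.
Definition lipreg n x : R := fine (lipreg_e n x).

Let lo_lip x y : lo x - L * `|x - y| <= lo y.
Proof.
have := ler_wpM2l L0 (ler_distD x y x0); rewrite (distrC y x) mulrDr /lo; lra.
Qed.

Let lipreg_e_ge n x : ((lo x)%:E <= lipreg_e n x)%E.
Proof.
apply: le_ereal_inf_tmp => _ [y _ <-].
apply: (@le_trans _ _ ((lo y)%:E + ((N + n)%:R * `|x - y|)%:E)%E); last by apply: leeD2r; exact: lo_le.
rewrite -EFinD lee_fin; have := lo_lip x y.
have : L * `|x - y| <= (N + n)%:R * `|x - y|.
  by rewrite ler_wpM2r// (le_trans LN)// ler_nat leq_addr.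
lra.
Qed.

Let lipreg_e_le n x : (lipreg_e n x <= (r + (N + n)%:R * `|x - x0|)%:E)%E.
Proof. by apply: ereal_inf_lbound; exists x0 => //; rewrite rE. Qed.

Let lipregK n x : (lipreg n x)%:E = lipreg_e n x.
Proof.
rewrite /lipreg fineK// fin_numE; apply/andP; split.
  by rewrite gt_eqF// (lt_le_trans _ (lipreg_e_ge n x))// ltNyr.
by rewrite lt_eqF// (le_lt_trans (lipreg_e_le n x))// ltry.
Qed.

Lemma lipreg_ge n x : lo x <= lipreg n x.
Proof. by rewrite -lee_fin lipregK. Qed.

Let lipreg_le n x : lipreg n x <= r + (N + n)%:R * `|x - x0|.
Proof. by rewrite -lee_fin lipregK. Qed.

Lemma lipreg_le_phi n x : ((lipreg n x)%:E <= phi x)%E.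
Proof.
by rewrite lipregK; apply: ereal_inf_lbound; exists x => //; rewrite subrr normr0 mulr0 adde0.
Qed.

Lemma lipreg_nd n m x : (n <= m)%N -> lipreg n x <= lipreg m x.
Proof.
move=> nm; rewrite -lee_fin !lipregK; apply: le_ereal_inf_tmp => _ [y _ <-].
apply: (@le_trans _ _ (phi y + ((N + n)%:R * `|x - y|)%:E)%E).
  by apply: ereal_inf_lbound; exists y.
by apply: leeD2l; rewrite lee_fin ler_wpM2r// ler_nat leq_add2l.
Qed.

Let lipreg_near n x e : 0 < e ->
  exists y q, phi y = q%:E /\ q + (N + n)%:R * `|x - y| < lipreg n x + e.
Proof.
move=> e0; have : (lipreg_e n x < (lipreg n x + e)%:E)%E.
  by rewrite -lipregK lte_fin ltrDl.
move=> /ereal_inf_lt[_ [y _ <-]]; have [nNy _ _ _] := Aphi.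
have := nNy y; case E : (phi y) => [q| |]// _.
by rewrite -EFinD lte_fin => h; exists y, q.
Qed.

(** As for any infimal convolution of convex functions, near-minimizers [u] and [v] for the two
    endpoints combine into a competitor for the intermediate point. *)
Lemma lipreg_convex n : convex_real (lipreg n).
Proof.
move=> x y t t01; have /andP[t0 t1] := t01; apply/ler_addgt0Pr => e e0.
have [u [a [ua hu]]] := lipreg_near n x e0.
have [v [b [vb hv]]] := lipreg_near n y e0.
have [_ _ _ cvx] := Aphi.
have h1 : ((lipreg n (t *: x + (1 - t) *: y))%:E <=
  phi (t *: u + (1 - t) *: v) +
  ((N + n)%:R * `|(t *: x + (1 - t) *: y) - (t *: u + (1 - t) *: v)|)%:E)%E.
  by rewrite lipregK; apply: ereal_inf_lbound; eexists.
have h2 := cvx u v t t01; rewrite ua vb -!EFinM -EFinD in h2.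
have := le_trans h1 (leeD2r _ h2); rewrite -EFinD lee_fin => h3.
have h4 : `|(t *: x + (1 - t) *: y) - (t *: u + (1 - t) *: v)| <=
    t * `|x - u| + (1 - t) * `|y - v|.
  rewrite opprD addrACA -!scalerBr (le_trans (ler_normD _ _))//.
  by rewrite !normrZ !ger0_norm// subr_ge0.
have h5 := ler_wpM2l (ler0n R (N + n)) h4.
have t1' : 0 <= 1 - t by rewrite subr_ge0.
have := ler_wpM2l t0 (ltW hu); have := ler_wpM2l t1' (ltW hv).
nra.
Qed.

(** Let [a] lie below [phi x]. Near x, lower semicontinuity keeps [phi] above [a]; away from x, a
    steep enough penalty lifts the minorant [lo] above [a]. *)
Lemma lipreg_cvg x : ((lipreg n x)%:E @[n --> \oo] --> phi x)%E.
Proof.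
have nd : nondecreasing_seq (fun n => (lipreg n x)%:E).
  by move=> n m nm; rewrite lee_fin; exact: lipreg_nd.
have := ereal_nondecreasing_cvgn nd; set S := ereal_sup _.
suff -> : S = phi x by [].
apply/eqP; rewrite eq_le; apply/andP; split.
  by apply: ge_ereal_sup => _ [n _ <-]; exact: lipreg_le_phi.
rewrite leNgt; apply/negP => Sphi.
have [a Sa aphi] : exists2 a : R, (S < a%:E)%E & (a%:E < phi x)%E.
  have SNy : (-oo < S)%E.
    apply: (@lt_le_trans _ _ (lipreg 0 x)%:E); first exact: ltNyr.
    by apply: ereal_sup_ubound; exists 0%N.
  case: S SNy Sphi => [q| |]// _; case E : (phi x) => [p| |]// Sp.
  - rewrite lte_fin in Sp; exists ((q + p) / 2); rewrite lte_fin; lra.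
  - by exists (q + 1); [rewrite lte_fin; lra|rewrite ltry].
have [_ _ lsc _] := Aphi.
have [W nW hW] := lsc x a aphi.
have /nbhs_ballP[rho /= rho0 hrho] := nW.
pose n := (Num.truncn (`|a - lo x| / rho)).+1.
have hn : a - lo x <= n%:R * rho.
  apply: le_trans (ler_norm _) _; rewrite -ler_pdivrMr//.
  by rewrite ltW// truncnS_gt.
have : (a%:E <= (lipreg n x)%:E)%E.
  rewrite lipregK; apply: le_ereal_inf_tmp => _ [y _ <-].
  have [hy|hy] := ltP `|x - y| rho.
    apply: (@le_trans _ _ (phi y)).
      by apply/ltW/hW/hrho; rewrite -ball_normE.
    by rewrite leeDl// lee_fin mulr_ge0.
  apply: (@le_trans _ _ ((lo y)%:E + ((N + n)%:R * `|x - y|)%:E)%E); last by apply: leeD2r; exact: lo_le.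
  rewrite -EFinD lee_fin natrD.
  have h1 := lo_lip x y; have h2 := ler_wpM2r (normr_ge0 (x - y)) LN.
  have h3 := ler_wpM2l (ler0n R n) hy; nra.
rewrite leNgt => /negP; apply; apply: le_lt_trans Sa.
by apply: ereal_sup_ubound; exists n.
Qed.

Variables (eta nu : probability X R).
Hypotheses (eta1 : finite_moment 1 eta) (nu1 : finite_moment 1 nu).
Hypotheses (cx : cx_le eta nu) (phinu : nu.-integrable setT phi).

Let lo_L1 (P : probability X R) : finite_moment 1 P -> L1 P lo.
Proof. by move=> f1; apply: L1B; [exact: L1_cst|apply: L1Z; exact: mxnorm_L1]. Qed.

Let lipreg_L1 n (P : probability X R) : finite_moment 1 P -> L1 P (lipreg n : X -> R).
Proof.
move=> f1; have Ll := lo_L1 f1.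
have L2 : L1 P (fun x : X => r + (N + n)%:R * `|(x : V) - x0|).
  by apply: L1D; [exact: L1_cst|apply: L1Z; exact: mxnorm_L1].
apply: (@L1_le _ _ _ _ _ (fun x : X => `|lo x| + `|r + (N + n)%:R * `|(x : V) - x0| |)).
- exact: convex_meas (@lipreg_convex n).
- move=> x; have h1 := lipreg_ge n x; have h2 := lipreg_le n x.
  have := ler_norm (r + (N + n)%:R * `|(x : V) - x0|).
  have := ler_norm (- lo x); rewrite normrN => h3 h4.
  have := normr_ge0 (lo x); have := normr_ge0 (r + (N + n)%:R * `|(x : V) - x0|).
  by rewrite ler_norml => h5 h6; apply/andP; split; lra.
- by apply: L1D; exact: L1_norm.
Qed.

(** The convex order tests real-valued functions, so it is applied to the regularizations,
    integrable under both measures. Monotone convergence, after subtracting the integrable minorant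
    [lo], passes to [phi]. *)
Lemma lipreg_cx_le : eta.-integrable setT phi /\
  (\int[eta]_x phi x <= \int[nu]_x phi x)%E.
Proof.
pose b := fine (\int[nu]_x phi x)%E.
have bE : (\int[nu]_x phi x = b%:E)%E by rewrite fineK//; exact: integrable_fin_num.
have exi (P : probability X R) n : finite_moment 1 P -> integral_exists P (lipreg n).
  move=> f1; left; have Lg := lipreg_L1 n f1.
  have Lm : L1 P (fun x : X => Num.max (lipreg n x) 0).
    apply: (@L1_le _ _ _ _ _ (fun x : X => `|lipreg n x|)); last exact: L1_norm.
      by apply: measurable_maxr; [exact: L1_meas Lg|exact: measurable_cst].
    by move=> x; have [h|h] := leP (lipreg n x) 0; rewrite ?normr0.
  by rewrite integral_E// ltry.
have Eb n : E eta (lipreg n) <= b.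
  have := cx (@lipreg_convex n) (exi _ _ eta1) (exi _ _ nu1).
  rewrite -lee_fin -!integral_E; [|exact: lipreg_L1..] => h.
  apply: le_trans h _; rewrite -bE; apply: integral_mono.
  - by apply/measurable_EFinP; exact: convex_meas (@lipreg_convex n).
  - exact: A_cx_meas.
  - by move=> x; exact: lipreg_le_phi.
have Ll := lo_L1 eta1.
pose f n (x : X) : \bar R := ((lipreg n x)%:E - (lo x)%:E)%E.
have cv : (\int[eta]_x f n x @[n --> \oo] --> \int[eta]_x (phi x - (lo x)%:E))%E.
  rewrite (_ : (fun x => _) = fun x : X => limn (f ^~ x)); last first.
    apply/funext => x; apply/esym/cvg_lim => //.
    apply: cvgeB; [by rewrite fin_num_adde_defl|exact: lipreg_cvg|exact: cvg_cst].
  apply: cvg_monotone_convergence => //.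
  - move=> n; apply: emeasurable_funB; apply/measurable_EFinP.
      exact: convex_meas (@lipreg_convex n).
    exact: L1_meas Ll.
  - by move=> n x _; rewrite /f -EFinB lee_fin subr_ge0 lipreg_ge.
  - by move=> x _ n m nm; rewrite /f -!EFinB lee_fin lerD2r lipreg_nd.
have mlo : measurable_fun setT (fun x : X => (lo x)%:E) by exact: measurable_int Ll.
have mphi := A_cx_meas.
have h : (\int[eta]_x (phi x - (lo x)%:E) <= (b - E eta lo)%:E)%E.
  rewrite -(cvg_lim _ cv)//; apply: lime_le; first by apply/cvg_ex; eexists; exact: cv.
  apply: nearW => n; rewrite (_ : (fun x => f n x) = fun x : X => (lipreg n x - lo x)%:E)//.
  rewrite integral_E; last by apply: L1B => //; exact: lipreg_L1.
  by rewrite lee_fin E_B ?lerD2r//; exact: lipreg_L1.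
have I1 : eta.-integrable setT (fun x : X => phi x - (lo x)%:E)%E.
  apply: (integrable_lower_bound (l := fun=> 0)).
  - exact: emeasurable_funB.
  - exact: L1_cst.
  - by move=> x; rewrite sube_ge0 ?lo_le.
  - by apply: le_lt_trans h _; rewrite ltry.
have pE (x : X) : phi x = ((phi x - (lo x)%:E) + (lo x)%:E)%E by rewrite subeK.
have I2 : eta.-integrable setT phi.
  rewrite (_ : phi = fun x : X => ((phi x - (lo x)%:E) + (lo x)%:E)%E); last exact/funext.
  exact: (integrableD measurableT I1 Ll).
split => //.
rewrite (eq_integral (fun x : X => ((phi x - (lo x)%:E) + (lo x)%:E)%E)); last by move=> x _.
rewrite (integralD measurableT I1 Ll) bE (integral_E Ll).
by apply: le_trans (leeD2r _ h) _; rewrite -EFinD subrK.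
Qed.

End LipschitzRegularization.

(** * Weak duality *)
Section WeakDuality.
Context (R : realType) (d : nat).
Local Notation V := 'rV[R]_d.
Local Notation X := (Rd R d).
Implicit Types (mu nu eta xi : probability X R) (phi : V -> \bar R).

Lemma A_cx_cx_le phi eta nu : A_cx phi -> finite_moment 1 eta -> finite_moment 1 nu ->
  cx_le eta nu -> nu.-integrable setT phi ->
  eta.-integrable setT phi /\ (\int[eta]_x phi x <= \int[nu]_x phi x)%E.
Proof.
move=> A e1 n1 cx hn; have [x0 [r [L [rE L0 lo]]]] := A_cx_minorant A.
exact: (lipreg_cx_le A rE L0 lo e1 n1 cx hn).
Qed.

Lemma L1_integral_exists mu (f : V -> R) : L1 mu (f : X -> R) -> integral_exists mu f.
Proof.
move=> Lf; left; have Lm : L1 mu (fun x : X => Num.max (f x) 0).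
  apply: (@L1_le _ _ _ _ _ (fun x : X => `|f x|)); last exact: L1_norm.
    by apply: measurable_maxr; [exact: L1_meas Lf|exact: measurable_cst].
  by move=> x; have [h|h] := leP (f x) 0; rewrite ?normr0.
by rewrite integral_E// ltry.
Qed.

(** The inequality Q2(phi)(x) <= phi(y) + |x - y|^2 is integrated along a coupling, and the convex
    order is applied to [phi]. The class of test functions is the largest one and the moment
    exponent is 1, so that all cases of (i) follow by inclusion. *)
Lemma weak_duality_i mu nu : finite_moment 1 nu ->
  (dual_i mu nu [set phi | A_cx phi /\ nu.-integrable setT phi] <=
   T2_to_set mu (Pcx_le 1 nu))%E.
Proof.
move=> n1; apply: ge_ereal_sup => _ [phi [A hn] <-].
apply: le_ereal_inf_tmp => _ [eta [e1 cx] <-].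
apply: le_ereal_inf_tmp => _ [pi c <-].
have [he hle] := A_cx_cx_le A e1 n1 cx hn.
have [->|] := eqVneq (\int[pi]_z (sqdist z.1 z.2)%:E)%E +oo%E; first exact: leey.
rewrite -ltey => /coupling_cost_L1 Lc.
have fn : (\int[nu]_x phi x)%E \is a fin_num by exact: integrable_fin_num.
rewrite leeBlDr// addeC.
apply: (@le_trans _ _ (\int[eta]_x phi x + \int[pi]_z (sqdist (z.1 : V) (z.2 : V))%:E)%E); last exact: leeD2r.
have mp := measurable_int _ he.
rewrite -(coupling_snd c mp) -(coupling_fst c (Q2_meas phi)).
rewrite -integralD//; last exact: coupling_integrable_snd c he.
apply: integral_mono.
- exact: (measurableT_comp (Q2_meas phi) measurable_fst).
- apply: emeasurable_funD; first exact: (measurableT_comp mp measurable_snd).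
  exact: measurable_int Lc.
by move=> z; exact: Q2_le.
Qed.

Lemma S_bk_growth2 k phi : (k = 1 \/ k = 2)%N -> S_bk k phi ->
  growth_bound 2 (fun x => fine (phi x)).
Proof.
move=> kE [_ _ [C hC]]; case: kE hC => -> hC; last by exists C.
exists (2 * `|C|) => x; apply: le_trans (hC x) _.
have h1 := enorm_ge0 x; have h2 := sqr_ge0 (enorm x - 1).
have h3 : C * (1 + enorm x) <= `|C| * (1 + enorm x).
  by rewrite ler_wpM2r ?ler_norm// addr_ge0.
rewrite expr1; apply: le_trans h3 _.
have h4 : 1 + enorm x <= 2 * (1 + enorm x ^+ 2) by nra.
by rewrite -mulrA mulrCA; exact: ler_wpM2l.
Qed.

Lemma S_bk_L1 k phi mu : (k = 1 \/ k = 2)%N -> S_bk k phi -> finite_moment 2 mu ->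
  L1 mu (fun x : X => fine (phi x)).
Proof.
move=> kE h m2; have [C hC] := S_bk_growth2 kE h; have [_ mphi _] := h.
apply: (@L1_le _ _ _ _ _ (fun x : X => C * (1 + dot x x))) => //.
  by move=> x; rewrite -enorm2.
by apply: L1Z; apply: L1D; [exact: L1_cst|exact: fm2P].
Qed.

Lemma S_bk_integrable k phi mu : (k = 1 \/ k = 2)%N -> S_bk k phi ->
  finite_moment 2 mu -> mu.-integrable setT (phi : X -> \bar R).
Proof.
move=> kE h m2; have [fin _ _] := h; have := S_bk_L1 kE h m2; rewrite /L1.
by congr (integrable _ _ _); apply/funext => x /=; rewrite fineK.
Qed.

(** The inequality phi(x) <= Q2bar(phi)(y) + |x - y|^2 is integrated along a coupling. When the cost
    is finite, [coupling_fm2] gives [xi] a second moment, which makes [phi] integrable under it;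
    when the integral of [Q2bar phi] is infinite, the dual value is -oo. *)
Lemma weak_duality_ii k mu nu : (k = 1 \/ k = 2)%N ->
  finite_moment 2 mu -> finite_moment 2 nu ->
  (dual_ii mu nu [set phi | A_cx phi /\ S_bk k phi] <= T2_from_set (Pcx_ge 1 mu) nu)%E.
Proof.
move=> kE m2 n2; apply: ge_ereal_sup => _ [phi [A S] <-].
apply: le_ereal_inf_tmp => _ [xi [x1 cx] <-].
apply: le_ereal_inf_tmp => _ [pi c <-].
have [->|] := eqVneq (\int[pi]_z (sqdist z.1 z.2)%:E)%E +oo%E; first exact: leey.
rewrite -ltey => cfin; have Lc := coupling_cost_L1 cfin.
have x2 := coupling_fm2 c n2 cfin.
have [fin _ _] := S; have [_ _ _ cvx] := A.
pose f (x : V) := fine (phi x).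
have fE x : phi x = (f x)%:E by rewrite fineK.
have Lf P : finite_moment 2 P -> L1 P (f : X -> R) := fun h => S_bk_L1 kE S h.
have cf : convex_real f.
  by move=> x y t t01; have := cvx x y t t01; rewrite !fE -!EFinM -EFinD lee_fin.
have h1 : (\int[mu]_x phi x <= \int[xi]_x phi x)%E.
  have := cx f cf (L1_integral_exists (Lf _ m2)) (L1_integral_exists (Lf _ x2)).
  by congr (_ <= _)%E; apply: eq_integral => x _; rewrite fE.
have muE : (\int[mu]_x phi x = (E mu f)%:E)%E.
  by rewrite -integral_E; [apply: eq_integral => x _; rewrite fE|exact: Lf].
have [->|] := eqVneq (\int[nu]_x Q2bar phi x)%E +oo%E.
  by rewrite muE addeNy leNye.
rewrite -ltey => qfin.
have IQ : nu.-integrable setT (Q2bar phi : X -> \bar R).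
  (* Taking x = y in the supremum gives [phi] as an integrable minorant. *)
  apply: (@integrable_lower_bound R _ X nu (Q2bar phi) f (Q2bar_meas phi) (Lf _ n2) _ qfin).
  move=> x; apply: le_trans (Q2bar_ge phi x x); rewrite fE.
  by rewrite sqdist_dot subrr dot0r sube0.
have fq : (\int[nu]_x Q2bar phi x)%E \is a fin_num by exact: integrable_fin_num.
rewrite leeBlDr// addeC; apply: le_trans h1 _.
have mphi := A_cx_meas A.
rewrite -(coupling_fst c mphi) -(coupling_snd c (Q2bar_meas phi)).
rewrite -integralD//; last exact: (coupling_integrable_snd c IQ).
apply: integral_mono.
- exact: (measurableT_comp mphi measurable_fst).
- apply: emeasurable_funD; first exact: (measurableT_comp (Q2bar_meas phi) measurable_snd).
  exact: measurable_int Lc.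
by move=> z; rewrite -leeBlDr//; exact: Q2bar_ge.
Qed.

Lemma C_bk_S_bk k phi : C_bk k phi -> S_bk k phi.
Proof. by move=> [fin cont gr]; split => //; exact: Rd_cont_meas. Qed.

Lemma C_b1_C_bk k phi : (k = 1 \/ k = 2)%N -> C_bk 1 phi -> C_bk k phi.
Proof.
move=> kE h; have [fin cont _] := h; case: kE => -> //; split => //.
by apply: (@S_bk_growth2 1); [left|exact: C_bk_S_bk].
Qed.

End WeakDuality.

(** * Monotonicity in the competing sets, and assembly of the equalities *)

Section DualMonotone.
Context (R : realType) (d : nat) (mu nu : probability (Rd R d) R).
Local Open Scope ereal_scope.

Lemma dual_i_mono (C C' : set ('rV[R]_d -> \bar R)) : C `<=` C' ->
  dual_i mu nu C <= dual_i mu nu C'.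
Proof. by move=> CC; apply: ereal_sup_le => _ [phi /CC h <-]; exists phi. Qed.

Lemma dual_ii_mono (C C' : set ('rV[R]_d -> \bar R)) : C `<=` C' ->
  dual_ii mu nu C <= dual_ii mu nu C'.
Proof. by move=> CC; apply: ereal_sup_le => _ [phi /CC h <-]; exists phi. Qed.

Lemma T2_to_set_P12 : T2_to_set mu (Pcx_le 1 nu) <= T2_to_set mu (Pcx_le 2 nu).
Proof.
apply: ereal_inf_le_tmp => _ [eta [e2 cx] <-]; exists eta => //; split => //.
exact: fm2_fm1.
Qed.

Lemma T2_from_set_P12 : T2_from_set (Pcx_ge 1 mu) nu <= T2_from_set (Pcx_ge 2 mu) nu.
Proof.
apply: ereal_inf_le_tmp => _ [xi [e2 cx] <-]; exists xi => //; split => //.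
exact: fm2_fm1.
Qed.

End DualMonotone.

Local Open Scope ereal_scope.

Theorem mainTheorem8 (R : realType) (d : nat) (mu nu : probability (Rd R d) R) :
  finite_moment 2 mu -> finite_moment 2 nu ->
  (* (i) *)
  (T2_to_set mu (Pcx_le 1 nu) = T2_to_set mu (Pcx_le 2 nu) /\
   T2_to_set mu (Pcx_le 1 nu) =
     dual_i mu nu [set phi | A_cx phi /\ nu.-integrable setT phi] /\
   forall k : nat, (k = 1 \/ k = 2)%N ->
     T2_to_set mu (Pcx_le 1 nu) = dual_i mu nu [set phi | A_cx phi /\ C_bk k phi] /\
     T2_to_set mu (Pcx_le 1 nu) = dual_i mu nu [set phi | A_cx phi /\ S_bk k phi]) /\
  (* (ii) *)
  (T2_from_set (Pcx_ge 1 mu) nu = T2_from_set (Pcx_ge 2 mu) nu /\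
   forall k : nat, (k = 1 \/ k = 2)%N ->
     T2_from_set (Pcx_ge 1 mu) nu = dual_ii mu nu [set phi | A_cx phi /\ C_bk k phi] /\
     T2_from_set (Pcx_ge 1 mu) nu = dual_ii mu nu [set phi | A_cx phi /\ S_bk k phi]).
Proof.
move=> mu2 nu2.
(* Each half of the theorem is a cycle of inequalities: the primal value with exponent 1, that with
   exponent 2, the duals over [C_bk 1], [C_bk k], [S_bk k] and, in (i), the integrable class, then
   back to the first by weak duality. *)
have C1C k : (k = 1 \/ k = 2)%N -> [set phi | A_cx phi /\ C_bk 1 phi] `<=`
    [set phi : 'rV[R]_d -> \bar R | A_cx phi /\ C_bk k phi].
  by move=> kE phi [A /(C_b1_C_bk kE)].
have CS k : [set phi | A_cx phi /\ C_bk k phi] `<=`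
    [set phi : 'rV[R]_d -> \bar R | A_cx phi /\ S_bk k phi].
  by move=> phi [A /C_bk_S_bk].
have SI k : (k = 1 \/ k = 2)%N -> [set phi | A_cx phi /\ S_bk k phi] `<=`
    [set phi : 'rV[R]_d -> \bar R | A_cx phi /\ nu.-integrable setT phi].
  by move=> kE phi [A S]; split => //; exact: S_bk_integrable kE S nu2.
have k1 : (1 = 1 \/ 1 = 2)%N by left.
have i12 := T2_to_set_P12 mu nu.
have istr := strong_duality_i mu2 nu2.
have iw := weak_duality_i mu (fm2_fm1 nu2).
have ii12 := T2_from_set_P12 mu nu.
have iis := strong_duality_ii mu2 nu2.
have i1I := dual_i_mono mu nu (subset_trans (@CS 1%N) (SI _ k1)).
split; split.
- apply/le_anti; rewrite i12 /=.
  exact: le_trans istr (le_trans i1I iw).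
- split.
    apply/le_anti; rewrite iw andbT.
    exact: le_trans i12 (le_trans istr i1I).
  move=> k kE.
  have h1 := dual_i_mono mu nu (C1C _ kE).
  have h2 := dual_i_mono mu nu (CS k).
  have h3 := dual_i_mono mu nu (SI _ kE).
  have h4 := le_trans i12 (le_trans istr h1).
  have h5 := le_trans h3 iw.
  by split; apply/le_anti; rewrite ?h4 ?h5 ?(le_trans h4 h2) ?(le_trans h2 h5).
- apply/le_anti; rewrite ii12 /=.
  apply: le_trans iis (le_trans (dual_ii_mono mu nu (@CS 1%N)) _).
  exact: weak_duality_ii.
- move=> k kE.
  have h1 := dual_ii_mono mu nu (C1C _ kE).
  have h2 := dual_ii_mono mu nu (CS k).
  have h5 := weak_duality_ii kE mu2 nu2.
  have h4 := le_trans ii12 (le_trans iis h1).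
  by split; apply/le_anti; rewrite ?h4 ?h5 ?(le_trans h4 h2) ?(le_trans h2 h5).
Qed.
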